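(* Let $G$ be a connected, simply connected simple algebraic group over $\mathbb{C}$ with maximal torus $A$, Borel subgroup $B\supseteq A$, Weyl group $W$, root system $R$, center $Z$. Fix an embedding of groups $\iota:\mathbb{Q}/\mathbb{Z}\hookrightarrow\mathbb{C}^\times$ and, for $x\in Z$, let $\mu_x\in P(R^\vee)/Q(R^\vee)$ correspond to $x$ under the induced isomorphism $Z\cong P(R^\vee)/Q(R^\vee)$. Then: (a) For every $x\in Z$ there exist $g\in W$ and a regular element $u\in A$ with $g(u)=xu$; moreover one can take $g=\psi(\mu_x)$. (b) For fixed $x\in Z$, the element $g\in W$ for which some regular $u\in A$ satisfies $g(u)=xu$ is uniquely determined up to conjugation in $W$. (c) The eigenvalues, with multiplicities, of such an element $g$ acting on $\mathrm{Lie}(A)$ are precisely the complex numbers $\varpi_i(x)^{-1}$, $i\in I$.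
   Context: $\{\alpha_i\}_{i\in I}$ are the simple roots determined by $B$ and $\varpi_i$ the fundamental weights; $X^*(A)=P(R)$ and $X_*(A)=Q(R^\vee)$. An element $u\in A$ is regular if $\alpha(u)\ne1$ for all $\alpha\in R$ (equivalently its $W$-stabilizer is trivial). The isomorphism $P(R^\vee)/Q(R^\vee)\cong Z$ induced by $\iota$ sends the class of $\mu\in P(R^\vee)$ to the element $x_\mu\in A$ with $\lambda(x_\mu)=\iota(\langle\lambda,\mu\rangle\bmod\mathbb{Z})$ for all $\lambda\in P(R)$. $\psi$: the extended affine Weyl group $W_e=P(R^\vee)\rtimes W$ acts on $V^*$ ($V=Q(R)\otimes\mathbb{R}$), $P(R^\vee)$ by translations and $W$ linearly; with $\tilde\alpha$ the highest root, $C=\{v:\langle\alpha_i,v\rangle>0\ \forall i,\ \langle\tilde\alpha,v\rangle<1\}$ is the fundamental alcove; since $W_a=Q(R^\vee)\rtimes W$ acts simply transitively on alcoves, the stabilizer $\Gamma_C$ of $C$ in $W_e$ maps isomorphically ($\xi$) onto $W_e/W_a\cong P(R^\vee)/Q(R^\vee)$, and $\psi=\mathrm{pr}\circ\xi^{-1}$ with $\mathrm{pr}:W_e\to W$ the projection. *)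

(* Defs.v *)
(* Root-datum encoding of a simply connected simple group
   over C.  Real numbers: Stdlib R (a rcfType via Rstruct);
   complex numbers: CC := R[i] (real_closed's complex). *)
From HB Require Import structures.
From mathcomp Require Import all_boot all_order all_algebra.
From mathcomp Require Import Rstruct complex.
Set Implicit Arguments. Unset Strict Implicit. Unset Printing Implicit Defensive.
Import Order.TTheory GRing.Theory Num.Theory.
Local Open Scope ring_scope.

Definition RR : Type := Rdefinitions.R.
Definition CC : Type := (Rdefinitions.R)[i].

Section RootDatum.
Variable n : nat.
(* Cartan matrix  Cm i j = < alpha_i^vee , alpha_j >,  index set I = 'I_n. *)
Variable Cm : 'M[int]_n.

Definition is_gcm : Prop :=
  [/\ forall i, Cm i i = 2,
      forall i j, i != j -> Cm i j <= 0
    & forall i j, (Cm i j == 0) = (Cm j i == 0)].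

Definition finite_type : Prop :=
  exists d : 'I_n -> int,
    [/\ forall i, 0 < d i,
        forall i j, d i * Cm i j = d j * Cm j i
      & forall c : 'I_n -> rat, (exists i, c i != 0) ->
          0 < \sum_i \sum_j c i * (d i)%:~R * (Cm i j)%:~R * c j].

Definition indecomposable : Prop :=
  forall J : {set 'I_n}, J != set0 -> J != setT ->
    exists i j, [/\ i \in J, j \notin J & Cm i j != 0].

Definition irreducible_finite_cartan : Prop :=
  [/\ (0 < n)%N, is_gcm, finite_type & indecomposable].

(* Weights P(R) = X^*(A) = Z^I, in the basis of fundamental weights
   (column vectors).  The simple root alpha_j is the j-th column of Cm. *)
Definition fweight (i : 'I_n) : 'cV[int]_n := delta_mx i 0.
Definition alpha (j : 'I_n) : 'cV[int]_n := col j Cm.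

(* simple reflection on P(R):  s_i(l) = l - <l, alpha_i^vee> alpha_i *)
Definition sref (i : 'I_n) : 'M[int]_n :=
  1%:M - alpha i *m (delta_mx 0 i : 'M[int]_(1, n)).

Definition Weyl (g : 'M[int]_n) : Prop :=
  exists s : seq 'I_n, g = foldr (fun i m => sref i *m m) 1%:M s.

Definition is_root (b : 'cV[int]_n) : Prop :=
  exists g i, Weyl g /\ b = g *m alpha i.

Definition highest_root (h : 'cV[int]_n) : Prop :=
  is_root h /\
  forall b, is_root b -> exists c : 'I_n -> nat, h - b = \sum_i alpha i *+ c i.

(* The torus A = Hom(P(R), C^x) = (C^x)^I, via u |-> (varpi_i(u))_i. *)
Definition torus (u : 'I_n -> CC) : Prop := forall k, u k != 0.

Definition char_eval (l : 'cV[int]_n) (u : 'I_n -> CC) : CC :=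
  \prod_k u k ^ (l k 0).

(* W-action on A: lambda(g u) = (g^{-1} lambda)(u) *)
Definition tact (g : 'M[int]_n) (u : 'I_n -> CC) : 'I_n -> CC :=
  fun k => char_eval (invmx g *m fweight k) u.

Definition regular (u : 'I_n -> CC) : Prop :=
  forall b, is_root b -> char_eval b u != 1.

Definition center (x : 'I_n -> CC) : Prop :=
  torus x /\ forall b, is_root b -> char_eval b x = 1.

(* V^* (V = Q(R) (x) R), coordinates v_k = <varpi_k, v>, i.e. in the basis
   of simple coroots; Q(R^vee) = Z^I in these coordinates. *)
Definition pairR (l : 'cV[int]_n) (v : 'cV[RR]_n) : RR :=
  \sum_k (l k 0)%:~R * v k 0.
Definition pairQ (l : 'cV[int]_n) (m : 'cV[rat]_n) : rat :=
  \sum_k (l k 0)%:~R * m k 0.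

(* P(R^vee) (rational coordinates suffice: all its elements are rational) *)
Definition coweight (m : 'cV[rat]_n) : Prop :=
  forall i, exists z : int, pairQ (alpha i) m = z%:~R.

Definition coroot_congr (m m' : 'cV[rat]_n) : Prop :=
  forall k, exists z : int, m k 0 - m' k 0 = z%:~R.

Definition dual_mx (g : 'M[int]_n) : 'M[int]_n := (invmx g)^T.

(* the element (nu, g) of W_e = P(R^vee) x| W acting on V^* *)
Definition eaff (nu : 'cV[rat]_n) (g : 'M[int]_n) (v : 'cV[RR]_n) : 'cV[RR]_n :=
  map_mx (fun q : rat => ratr q) nu
  + map_mx (fun z : int => z%:~R) (dual_mx g) *m v.

Definition alcove (h : 'cV[int]_n) (v : 'cV[RR]_n) : Prop :=
  (forall i, 0 < pairR (alpha i) v) /\ pairR h v < 1.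

Definition stabilizes_alcove (h : 'cV[int]_n) (nu : 'cV[rat]_n)
    (g : 'M[int]_n) : Prop :=
  (forall v, alcove h v -> alcove h (eaff nu g v)) /\
  (forall v', alcove h v' -> exists v, alcove h v /\ eaff nu g v = v').

(* psi(m) = g : g is the linear part of the element of Gamma_C whose class
   in W_e / W_a = P(R^vee)/Q(R^vee) is the class of m *)
Definition is_psi (m : 'cV[rat]_n) (g : 'M[int]_n) : Prop :=
  Weyl g /\ exists nu h, [/\ coweight nu, coroot_congr nu m,
                             highest_root h & stabilizes_alcove h nu g].

(* action of g on Lie(A) = X_*(A) (x) C = Q(R^vee) (x) C *)
Definition lie_act (g : 'M[int]_n) : 'M[CC]_n :=
  map_mx (fun z : int => z%:~R) (dual_mx g).

End RootDatum.

(* an embedding of groups  iota : Q/Z -> C^x, given as a homomorphism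
   Q -> C^x with kernel exactly Z *)
Definition QZ_embedding (iota : rat -> CC) : Prop :=
  (forall a b, iota (a + b) = iota a * iota b) /\
  (forall a, iota a = 1 <-> exists z : int, a = z%:~R).

(* Main.v *)
Require Import Defs.
From HB Require Import structures.
From mathcomp Require Import all_boot all_order all_algebra.
From mathcomp Require Import fingroup perm Rstruct complex.
From mathcomp Require Import boolp reals sequences exp trigo ring lra zify.
Set Implicit Arguments. Unset Strict Implicit. Unset Printing Implicit Defensive.
Import Order.TTheory GRing.Theory Num.Theory.
Local Open Scope ring_scope.

(* Let X(u) be the matrix of logarithmic differentials at u of the orbit sums of
   the fundamental weights.  Its determinant is W-antisymmetric with all weights
   <= rho and positive coefficient at rho, hence a positive multiple of the Weyl
   denominator, and X(u) is invertible for u regular.  Since X(g u) = X(u) g^T and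
   X(x u) = diag(varpi_i(x)) X(u) for x central, g(u) = x u determines the
   eigenvalues of g; for x = 1 it shows that regular elements have trivial
   stabilizer.
   An element of W_e preserving the alcove fixes the average p of an orbit, a
   regular point, and u = iota(-p) solves g(u) = x u for its linear part g.
   Conversely, any regular solution can be deformed into the compact torus and
   then moved by W_a into the alcove, so that a conjugate of g becomes the linear
   part of an element of W_e, in the class of -mu modulo W_a, that fixes a point
   of the alcove.  Two such elements differ by an element of W_a preserving the
   alcove; it fixes a regular point of the alcove, hence is trivial. *)

(** [iota] is a bare homomorphism on the rationals, unrelated to the analytic exponential, whereas a
    regular [u] in (b) has arbitrary complex coordinates. The alcove geometry is therefore developed
    over any archimedean ordered field [F] and carried to the torus by any
    additive-to-multiplicative [E : F -> CC] whose kernel is the integers: [iota] over [rat] for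
    (a), [polar 0] over the reals for (b), where [x] receives a logarithm [th] of its own. The
    determinant is identified by rigidity: an antisymmetric integral combination of characters with
    weights below [rho] vanishes as soon as its coefficient at [rho] does. The facts on roots behind
    this (signs, exchange, finiteness of W) are drawn from the positive definite form together with
    the integrality of roots and coroots. *)

Lemma finite_of_injective (T : eqType) (F : finType) (P : T -> Prop) (phi : T -> F) :
  (forall x y, P x -> P y -> phi x = phi y -> x = y) ->
  exists s : seq T, uniq s /\ forall x, (x \in s) <-> P x.
Proof.
move=> inj.
(* [P] need not be decidable, so preimages under [phi] are picked by classical choice. *)
pose pre y := if pselect (exists x, P x /\ phi x = y) is left e
              then [:: projT1 (cid e)] else [::].
pose s := undup (flatten [seq pre y | y <- enum F]).
exists s; split=> [|x]; first exact: undup_uniq.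
rewrite mem_undup; split.
  case/flattenP=> l /mapP[y _ ->]; rewrite /pre.
  case: pselect => // e; rewrite inE => /eqP ->.
  by case: (projT2 (cid e)).
move=> Px; apply/flattenP; exists (pre (phi x)).
  by apply/mapP; exists (phi x); rewrite ?mem_enum.
rewrite /pre; case: pselect => [e|[]]; last by exists x.
rewrite inE; apply/eqP; case: (projT2 (cid e)) => Py e'.
by apply: inj.
Qed.

(** * Polar coordinates *)

Section Polar.
Variable R : realType.
Implicit Types a t : R.

(** The number exp(a + 2 pi i t); with this scaling the kernel in [t] is exactly the integers, as
    for [iota]. *)
Definition polar a t : R[i] :=
  Complex (expR a * cos ((pi *+ 2) * t)) (expR a * sin ((pi *+ 2) * t)).

Lemma polarD a a' t t' : polar (a + a') (t + t') = polar a t * polar a' t'.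
Proof.
rewrite /polar expRD mulrDr cosD sinD; apply/eqP; rewrite eq_complex /=.
by apply/andP; split; apply/eqP; ring.
Qed.

Lemma polar00 : polar 0 0 = 1.
Proof. by rewrite /polar expR0 mulr0 cos0 sin0 mulr1 mulr0. Qed.

Lemma polar_nat (k : nat) : polar 0 k%:R = 1.
Proof.
elim: k => [|k IH]; first exact: polar00.
rewrite -[X in polar X]addr0 -addn1 natrD polarD IH mul1r /polar expR0 !mul1r mulr1.
by rewrite cos2pi sin2pi.
Qed.

Lemma polar_int (z : int) : polar 0 z%:~R = 1.
Proof.
case: z => k; first exact: polar_nat.
have := polarD 0 0 (- k.+1%:R) k.+1%:R.
by rewrite polar_nat mulr1 addr0 addNr polar00 => h; apply: esym h.
Qed.

Lemma cos_2pi_eq1 t : 0 <= t <= 1 / 2 -> cos ((pi *+ 2) * t) = 1 -> t = 0.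
Proof.
move=> /andP[t0 t1] e; rewrite -(cos0 R) in e.
have p0 := pi_gt0 R.
have : (pi *+ 2) * t = 0.
  by apply: cos_inj e; rewrite in_itv /=; apply/andP; split; nra.
by move=> /eqP; rewrite mulf_eq0 mulrn_eq0 (gt_eqF p0) => /eqP.
Qed.

Lemma polar_eq1 a t : polar a t = 1 -> a = 0 /\ t \is a Num.int.
Proof.
move/eqP; rewrite eq_complex /= => /andP[/eqP c1 /eqP s0].
have e0 := expR_gt0 a; have cs := cos2Dsin2 ((pi *+ 2) * t).
have st : sin ((pi *+ 2) * t) = 0.
  by apply/eqP; move/eqP: s0; rewrite mulf_eq0 gt_eqF.
have ct : cos ((pi *+ 2) * t) = 1.
  move: cs; rewrite st expr0n addr0 => /eqP; rewrite sqrf_eq1 => /orP[/eqP //|/eqP e].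
  by move: c1; rewrite e; lra.
split; first by apply: expR_inj; rewrite expR0 -c1 ct mulr1.
have tp : polar 0 t = 1 by rewrite /polar ct st expR0 mulr1 mulr0.
pose s := t - (Num.floor t)%:~R.
have /andP[f1 f2] := floor_itv t; rewrite intrD in f2.
have sp : polar 0 s = 1.
  have := polarD 0 0 t (- Num.floor t)%:~R.
  by rewrite polar_int mulr1 tp addr0 intrN.
have s1 : s = 0.
  (* Cosine is injective only on half a period; past 1/2, [1 - s] has the same cosine. *)
  have [sh|sh] := lerP s (1 / 2).
    apply: cos_2pi_eq1; first by rewrite sh subr_ge0 f1.
    by move/eqP: sp; rewrite eq_complex /polar expR0 mul1r => /andP[/eqP].
  have : 1 - s = 0; last by rewrite /s; lra.
  apply: cos_2pi_eq1; first by apply/andP; rewrite /s in sh *; split; lra.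
  rewrite mulrBr mulr1 addrC cosD2pi cosN.
  by move/eqP: sp; rewrite eq_complex /polar expR0 mul1r => /andP[/eqP].
have -> : t = (Num.floor t)%:~R by rewrite -[RHS]addr0 -s1 /s; ring.
exact: intr_int.
Qed.

Lemma polar_surj (z : R[i]) : z != 0 -> exists a t, z = polar a t.
Proof.
case: z => x y; rewrite eq_complex /= negb_and => z0.
have p0 := pi_gt0 R.
have N0 : 0 < x ^+ 2 + y ^+ 2.
  rewrite lt_def addr_ge0 ?sqr_ge0 // andbT paddr_eq0 ?sqr_ge0 // !sqrf_eq0.
  by rewrite negb_and.
pose r := Num.sqrt (x ^+ 2 + y ^+ 2).
have r0 : 0 < r by rewrite sqrtr_gt0.
have rr : r ^+ 2 = x ^+ 2 + y ^+ 2 by rewrite sqr_sqrtr // ltW.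
have c1 : -1 <= x / r <= 1.
  have h : `|x| <= r by rewrite -sqrtr_sqr ler_wsqrtr // lerDl sqr_ge0.
  by rewrite -ler_norml normrM normfV (gtr0_norm r0) ler_pdivrMr // mul1r.
pose th := if 0 <= y then acos (x / r) else - acos (x / r).
have ac : cos (acos (x / r)) = x / r by apply: acosK; rewrite in_itv.
have ct : cos th = x / r by rewrite /th; case: ifP; rewrite ?cosN ac.
have as_ : sin (acos (x / r)) = `|y| / r.
  rewrite sin_acos //; have -> : 1 - (x / r) ^+ 2 = (y / r) ^+ 2.
    have r2 : r ^+ 2 != 0 by rewrite expf_neq0 // gt_eqF.
    by apply: (mulIf r2); rewrite mulrBl mul1r !expr_div_n !divfK // rr; ring.
  by rewrite sqrtr_sqr normrM normfV (gtr0_norm r0).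
have st : sin th = y / r.
  rewrite /th; case: ifP => [h|/negbT h]; first by rewrite as_ ger0_norm.
  by rewrite sinN as_ ltr0_norm ?mulNr ?opprK // ltNge.
exists (ln r), (th / (pi *+ 2)).
have p2 : pi *+ 2 != 0 :> R by rewrite mulrn_eq0 (gt_eqF p0).
have e : (pi *+ 2) * (th / (pi *+ 2)) = th by rewrite mulrC divfK.
rewrite /polar lnK ?posrE // e ct st.
by congr Complex; field; rewrite gt_eqF.
Qed.

End Polar.

(** * Words in the simple reflections *)

Section RootTheory.
Variables (n : nat) (Cm : 'M[int]_n) (d : 'I_n -> int).
Hypothesis Cm_diag : forall i, Cm i i = 2.
Hypothesis Cm_off : forall i j, i != j -> Cm i j <= 0.
Hypothesis d_gt0 : forall i, 0 < d i.
Hypothesis d_sym : forall i j, d i * Cm i j = d j * Cm j i.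
Hypothesis d_posdef : forall c : 'I_n -> rat, (exists i, c i != 0) ->
  0 < \sum_i \sum_j c i * (d i)%:~R * (Cm i j)%:~R * c j.

Local Notation S := (sref Cm).
Local Notation al := (alpha Cm).
Local Notation W := (Weyl Cm).
Local Notation root := (is_root Cm).
Local Notation Q m := (map_mx (fun z : int => z%:~R : rat) m).

Definition word (s : seq 'I_n) : 'M[int]_n := foldr (fun i m => S i *m m) 1%:M s.

Lemma sref_colE i (l : 'cV[int]_n) : S i *m l = l - l i 0 *: al i.
Proof.
rewrite /sref mulmxBl mul1mx -mulmxA -rowE.
have -> : row i l = (l i 0)%:M.
  by apply/matrixP=> a b; rewrite !mxE !ord1 eqxx mulr1n.
by rewrite mul_mx_scalar.
Qed.

Lemma sref_alpha i : S i *m al i = - al i.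
Proof.
rewrite sref_colE mxE Cm_diag scaler_nat mulr2n opprD addrA subrr.
by rewrite add0r.
Qed.

Lemma sref_invol i : S i *m S i = 1%:M.
Proof.
rewrite {2}/sref mulmxBr mulmx1 mulmxA sref_alpha mulNmx opprK /sref.
by rewrite subrK.
Qed.

Lemma word_cat s t : word (s ++ t) = word s *m word t.
Proof. by elim: s => [|i s IH] /=; rewrite ?mul1mx // IH mulmxA. Qed.

Lemma word_rcons s i : word (rcons s i) = word s *m S i.
Proof. by rewrite -cats1 word_cat /= mulmx1. Qed.

Lemma Weyl1 : W 1%:M. Proof. by exists [::]. Qed.

Lemma WeylM g h : W g -> W h -> W (g *m h).
Proof. by move=> [s ->] [t ->]; exists (s ++ t); apply/esym/word_cat. Qed.

Lemma Weyl_sref i : W (S i).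
Proof. by exists [:: i]; rewrite /= mulmx1. Qed.

Lemma Weyl_ind (P : 'M[int]_n -> Prop) :
  P 1%:M -> (forall i g, W g -> P g -> P (S i *m g)) -> forall g, W g -> P g.
Proof.
move=> P1 PS g [s ->]; elim: s => //= i s IH.
by apply: PS => //; exists s.
Qed.

Lemma word_rev s : word s *m word (rev s) = 1%:M.
Proof.
elim: s => [|i s IH]; first by rewrite mulmx1.
rewrite rev_cons word_rcons /= mulmxA -(mulmxA (S i)) IH mulmx1.
exact: sref_invol.
Qed.

Lemma Weyl_unit g : W g -> g \in unitmx.
Proof. by case=> s ->; case/mulmx1_unit: (word_rev s). Qed.

Lemma Weyl_inv g : W g -> W (invmx g).
Proof.
move=> Wg; have [s e] := Wg; exists (rev s).
rewrite -/(word _) -[RHS]mul1mx -(mulVmx (Weyl_unit Wg)) -mulmxA {3}e.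
by rewrite -/(word s) word_rev mulmx1.
Qed.

Lemma root_Weyl g b : W g -> root b -> root (g *m b).
Proof.
move=> Wg [h [i [Wh ->]]]; exists (g *m h), i.
by rewrite mulmxA; split=> //; apply: WeylM.
Qed.

Lemma root_alpha i : root (al i).
Proof. by exists 1%:M, i; rewrite mul1mx; split=> //; apply: Weyl1. Qed.

Lemma root_opp b : root b -> root (- b).
Proof.
case=> g [i [Wg ->]]; exists (g *m S i), i.
rewrite -mulmxA sref_alpha mulmxN; split=> //.
by apply: WeylM => //; apply: Weyl_sref.
Qed.

(** * The invariant form *)

Definition dmx : 'M[rat]_n := diag_mx (\row_i (d i)%:~R).
(** The Gram matrix of the fundamental weights for the form in which alpha_i has squared length
    [2 * d i]: varpi_i pairs with alpha_i to [d i] and with the other simple roots to 0. *)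
Definition gram : 'M[rat]_n := locked (dmx *m invmx (Q Cm)).
Definition bform (x y : 'cV[rat]_n) : rat := (x^T *m gram *m y) 0 0.

Lemma dmx_Cm : dmx *m Q Cm = (Q Cm)^T *m dmx.
Proof.
apply/matrixP=> i j; rewrite mul_diag_mx mul_mx_diag !mxE.
by rewrite -!rmorphM /= d_sym mulrC.
Qed.

Lemma quad_gt0 (c : 'cV[rat]_n) : c != 0 -> 0 < (c^T *m dmx *m Q Cm *m c) 0 0.
Proof.
move=> c0; have [i ci] : exists i, c i 0 != 0.
  apply/existsP; apply: contraNT c0 => /existsPn h.
  by apply/eqP/colP=> i; rewrite mxE; apply/eqP; move: (h i); rewrite negbK.
have e : (c^T *m dmx *m Q Cm *m c) 0 0 =
    \sum_i \sum_j c i 0 * (d i)%:~R * (Cm i j)%:~R * c j 0.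
  rewrite mxE exchange_big /=; apply: eq_bigr => j _.
  rewrite mxE big_distrl /=; apply: eq_bigr => k _.
  by rewrite mul_mx_diag !mxE.
by rewrite e; apply: d_posdef; exists i.
Qed.

Lemma CmQ_unit : Q Cm \in unitmx.
Proof.
rewrite -unitmx_tr -row_free_unit -kermx_eq0; apply/rowV0P => v /sub_kermxP Hv.
apply/eqP; apply: contraT => v0.
have v0' : v^T != 0 by rewrite trmx_eq0.
have := quad_gt0 v0'; rewrite trmxK -mulmxA.
have -> : Q Cm *m v^T = 0 by rewrite -[Q Cm]trmxK -trmx_mul Hv trmx0.
by rewrite mulmx0 mxE ltxx.
Qed.

Lemma Q_alpha i : Q (al i) = Q Cm *m delta_mx i 0.
Proof. by rewrite /alpha map_col colE. Qed.

Lemma gram_Cm : gram *m Q Cm = dmx.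
Proof. by rewrite /gram -lock -mulmxA mulVmx ?mulmx1 ?CmQ_unit. Qed.

Lemma gram_sym : gram^T = gram.
Proof.
have e : (Q Cm)^T *m gram = dmx.
  by apply: (can_inj (mulmxK CmQ_unit)); rewrite -mulmxA gram_Cm dmx_Cm.
have tu : (Q Cm)^T \in unitmx by rewrite unitmx_tr CmQ_unit.
apply: (can_inj (mulKmx tu)).
by rewrite e -trmx_mul gram_Cm tr_diag_mx.
Qed.

Lemma dmx_delta i : dmx *m delta_mx i 0 = (d i)%:~R *: (delta_mx i 0 : 'cV_n).
Proof.
apply/colP=> k; rewrite mul_diag_mx !mxE.
by case: eqP => [->|] //=; rewrite ?mulr0.
Qed.

Lemma gram_alpha i : gram *m Q (al i) = (d i)%:~R *: delta_mx i 0.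
Proof. by rewrite Q_alpha mulmxA gram_Cm dmx_delta. Qed.

Lemma bform_alpha x i : bform x (Q (al i)) = (d i)%:~R * x i 0.
Proof.
rewrite /bform -mulmxA gram_alpha -scalemxAr mxE -colE.
by rewrite !mxE.
Qed.

Lemma bformC x y : bform x y = bform y x.
Proof.
have -> : bform y x = (x^T *m gram *m y)^T 0 0.
  by rewrite (trmx_mul _ y) (trmx_mul x^T) trmxK gram_sym mulmxA.
by rewrite mxE.
Qed.

Lemma bformDl x x' y : bform (x + x') y = bform x y + bform x' y.
Proof. by rewrite /bform linearD /= !mulmxDl mxE. Qed.

Lemma bformZl a x y : bform (a *: x) y = a * bform x y.
Proof. by rewrite /bform linearZ /= -!scalemxAl mxE. Qed.

Lemma bformDr x y y' : bform x (y + y') = bform x y + bform x y'.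
Proof. by rewrite bformC bformDl !(bformC _ x). Qed.

Lemma bformZr a x y : bform x (a *: y) = a * bform x y.
Proof. by rewrite bformC bformZl bformC. Qed.

Lemma bform_gt0 x : x != 0 -> 0 < bform x x.
Proof.
move=> x0; have [c xE] : exists c, x = Q Cm *m c.
  by exists (invmx (Q Cm) *m x); rewrite mulKVmx ?CmQ_unit.
have c0 : c != 0 by apply: contraNneq x0 => c0; rewrite xE c0 mulmx0.
rewrite /bform xE trmx_mul -!mulmxA (mulmxA gram) gram_Cm (mulmxA _ dmx).
by rewrite -dmx_Cm !mulmxA quad_gt0.
Qed.

Lemma bform_ge0 x : 0 <= bform x x.
Proof.
have [->|/bform_gt0/ltW //] := eqVneq x 0.
by rewrite /bform mulmx0 mxE.
Qed.

Lemma bform_CS x y : bform x y ^+ 2 <= bform x x * bform y y.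
Proof.
have [->|y0] := eqVneq y 0.
  by rewrite /bform !mulmx0 !mxE expr0n mulr0.
have By := bform_gt0 y0; set t := bform x y / bform y y.
have := bform_ge0 (x + (- t) *: y).
rewrite bformDl !bformDr !bformZl !bformZr (bformC y x).
have -> : bform x x + - t * bform x y + (- t * bform x y + - t * (- t * bform y y))
  = (bform x x * bform y y - bform x y ^+ 2) / bform y y.
  by rewrite /t; field; rewrite gt_eqF.
by rewrite pmulr_lge0 ?invr_gt0 // subr_ge0.
Qed.

Lemma sref_gram i : (Q (S i))^T *m gram *m Q (S i) = gram.
Proof.
have SE : Q (S i) = 1%:M - Q (al i) *m delta_mx 0 i.
  rewrite /sref map_mxB map_mx1 map_mxM; congr (_ - _ *m _).
  by apply/matrixP=> a b; rewrite !mxE; case: (_ && _).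
have GS : gram *m Q (S i) = gram - (d i)%:~R *: ((delta_mx i 0 : 'cV_n) *m delta_mx 0 i).
  by rewrite SE mulmxBr mulmx1 mulmxA gram_alpha -scalemxAl.
have ST : (Q (S i))^T = 1%:M - (delta_mx i 0 : 'cV_n) *m (Q (al i))^T.
  by rewrite SE linearB /= trmx1 trmx_mul trmx_delta.
have aG : (Q (al i))^T *m gram = (d i)%:~R *: delta_mx 0 i.
  by rewrite -gram_sym -trmx_mul gram_alpha linearZ /= trmx_delta.
rewrite -mulmxA GS ST mulmxBl mul1mx -(mulmxA (delta_mx i 0)) (mulmxBr (Q (al i))^T) aG.
have -> : (Q (al i))^T *m ((d i)%:~R *: ((delta_mx i 0 : 'cV_n) *m delta_mx 0 i))
   = ((d i)%:~R *+ 2) *: delta_mx 0 i.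
  rewrite -scalemxAr mulmxA -colE.
  have -> : col i (Q (al i))^T = 2%:M.
    by apply/matrixP=> a b; rewrite !mxE !ord1 Cm_diag.
  by rewrite mul_scalar_mx scalerA mulr_natr.
by rewrite -scalerBl mulr2n opprD addrA subrr add0r scaleNr mulmxN -scalemxAr opprK subrK.
Qed.

Lemma Weyl_gram g : W g -> (Q g)^T *m gram *m Q g = gram.
Proof.
move: g; apply: (Weyl_ind (P := fun g => (Q g)^T *m gram *m Q g = gram)) => [|i h _ IH].
  by rewrite map_mx1 trmx1 mul1mx mulmx1.
by rewrite map_mxM trmx_mul -!mulmxA (mulmxA _ gram) (mulmxA _ (Q (S i))) sref_gram mulmxA.
Qed.

Lemma bform_Weyl g x y : W g -> bform (Q g *m x) (Q g *m y) = bform x y.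
Proof.
move=> Wg; rewrite /bform trmx_mul -!mulmxA (mulmxA gram) (mulmxA _ _ y) mulmxA.
by rewrite (mulmxA _ gram) Weyl_gram // !mulmxA.
Qed.

Lemma bform_alpha_alpha i : bform (Q (al i)) (Q (al i)) = 2 * (d i)%:~R.
Proof. by rewrite bform_alpha !mxE Cm_diag mulrC. Qed.

Lemma Cm_inj : injective (fun c : 'cV[int]_n => Cm *m c).
Proof.
move=> c c' /(congr1 (fun m => Q m)); rewrite !map_mxM.
move=> /(can_inj (mulKmx CmQ_unit)) e.
by apply/colP=> i; move/colP: e => /(_ i); rewrite !mxE => /intr_inj.
Qed.

(** * Roots are nonnegative or nonpositive *)

(* Write [c = ga - m e_j] with [m > 0].  The coroot of [b = Cm c] has integral
   [j]-th coordinate [- m d_j / d_k], so [m d_j >= d_k]; but [m^2 * 2 d_j] is less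
   than the squared length [2 d_k] of [b], as [ga] pairs nonpositively with [al j]. *)
Lemma root_coord_ge0 (c : 'cV[int]_n) (j k : 'I_n) (z : int) :
  (forall i, i != j -> 0 <= c i 0) -> (exists2 i, i != j & c i 0 != 0) ->
  c j 0 * d j = z * d k ->
  bform (Q (Cm *m c)) (Q (Cm *m c)) = 2 * (d k)%:~R ->
  0 <= c j 0.
Proof.
move=> c_ge0 [i0 i0j ci0] cz; rewrite leNgt => cN; apply/negP=> cj_lt0.
pose m := - c j 0; pose ga := c + m *: delta_mx j 0.
have gaj : ga j 0 = 0 by rewrite !mxE !eqxx mulr1 subrr.
have gaE i : i != j -> ga i 0 = c i 0 by move=> ij; rewrite !mxE (negPf ij) mulr0 addr0.
have cE : Q (Cm *m c) = Q (Cm *m ga) + (- m%:~R) *: Q (al j).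
  rewrite /ga mulmxDr -scalemxAr -colE map_mxD map_mxZ -/(al j) -addrA.
  by rewrite -scalerDl subrr scale0r addr0.
have g0 : Q (Cm *m ga) != 0.
  apply/eqP=> e; have : ga = 0.
    apply: Cm_inj; rewrite mulmx0; apply/colP=> i.
    by move/colP: e => /(_ i); rewrite !mxE => /eqP; rewrite intr_eq0 => /eqP.
  by move/colP=> /(_ i0); rewrite gaE // mxE; apply/eqP.
have Bg := bform_gt0 g0.
have gaj_le0 : (Cm *m ga) j 0 <= 0.
  rewrite mxE sumr_le0 // => l _; have [->|lj] := eqVneq l j.
    by rewrite gaj mulr0.
  by rewrite gaE // mulr_le0_ge0 ?c_ge0 // Cm_off // eq_sym.
move: cN; rewrite cE bformDl !bformDr !bformZl !bformZr (bformC (Q (al j))).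
rewrite bform_alpha_alpha bform_alpha [Q _ j 0]mxE.
have mz : m * d j = - z * d k by rewrite /m !mulNr cz.
have m_gt0 : 0 < m by rewrite oppr_gt0.
have dk := d_gt0 k; have dj := d_gt0 j.
have le1 : d k <= m * d j.
  have z_lt0 : z < 0 by nia.
  by rewrite mz; nia.
have le2 : d k <= m * (m * d j) by nia.
have le2' : (d k)%:~R <= m%:~R * (m%:~R * (d j)%:~R) :> rat.
  by rewrite -!rmorphM ler_int.
have le3 : m%:~R * ((d j)%:~R * ((Cm *m ga) j 0)%:~R) <= 0 :> rat.
  by rewrite -!rmorphM lerz0 mulr_ge0_le0 ?(ltW m_gt0) // mulr_ge0_le0 ?(ltW dj).
lra.
Qed.

Lemma bform_Cm x (y : 'cV[rat]_n) :
  bform x (Q Cm *m y) = \sum_i (d i)%:~R * x i 0 * y i 0.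
Proof.
rewrite /bform mulmxA -(mulmxA x^T) gram_Cm mxE; apply: eq_bigr => i _.
by rewrite mul_mx_diag !mxE (mulrC (x i 0)).
Qed.

Definition rootlat_ge0 (b : 'cV[int]_n) : Prop :=
  exists2 c : 'cV[int]_n, (forall i, 0 <= c i 0) & b = Cm *m c.

Definition scoord (j : 'I_n) (c : 'cV[int]_n) : 'cV[int]_n :=
  c - (Cm *m c) j 0 *: delta_mx j 0.

Lemma scoordE j c : Cm *m scoord j c = S j *m (Cm *m c).
Proof. by rewrite /scoord mulmxBr -scalemxAr -colE -/(al j) sref_colE. Qed.

Lemma scoord_neq j c l : l != j -> scoord j c l 0 = c l 0.
Proof. by move=> lj; rewrite !mxE (negPf lj) mulr0 subr0. Qed.

Lemma scoord_eq j c : scoord j c j 0 = c j 0 - (Cm *m c) j 0.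
Proof. by rewrite !mxE !eqxx mulr1. Qed.

(** Only the [j]-th coordinate changes. If another one is nonzero, it stays positive and
    [root_coord_ge0] applies; otherwise the root is a multiple of [al j] and is negated. *)
Lemma scoord_sign j (c z : 'cV[int]_n) (k : 'I_n) :
  (forall l, 0 <= c l 0) -> (forall l, scoord j c l 0 * d l = z l 0 * d k) ->
  bform (Q (Cm *m c)) (Q (Cm *m c)) = 2 * (d k)%:~R ->
  (forall l, 0 <= scoord j c l 0) \/ (forall l, scoord j c l 0 <= 0).
Proof.
move=> c0 cz cN; have [/existsP[l /andP[lj cl]]|/existsPn h] :=
  boolP [exists l, (l != j) && (c l 0 != 0)].
  left=> m; have [->|mj] := eqVneq m j; last by rewrite scoord_neq.
  apply: (@root_coord_ge0 _ j k (z j 0)) => //.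
  - by move=> i ij; rewrite scoord_neq.
  - by exists l => //; rewrite scoord_neq.
  by rewrite scoordE !map_mxM bform_Weyl -?map_mxM //; apply: Weyl_sref.
have cE l : l != j -> c l 0 = 0.
  by move=> lj; move: (h l); rewrite lj negbK => /eqP.
right=> m; have [->|mj] := eqVneq m j; last by rewrite scoord_neq // cE.
rewrite scoord_eq mxE (bigD1 j) //= big1 => [|l lj]; last by rewrite cE ?mulr0.
by rewrite Cm_diag addr0; have := c0 j; lia.
Qed.

(** [z] holds the coordinates of the coroot in the simple coroots, the coroot of alpha_l being
    alpha_l / [d l]. Its integrality, carried along the word, is what [root_coord_ge0] consumes at
    each step. *)
Lemma root_coords g k : W g -> exists c z : 'cV[int]_n,
  [/\ g *m al k = Cm *m c, forall l, c l 0 * d l = z l 0 * d k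
    & (forall l, 0 <= c l 0) \/ (forall l, c l 0 <= 0)].
Proof.
move: g; apply: Weyl_ind => [|j g Wg [c [z [gE cz csgn]]]].
  exists (delta_mx k 0), (delta_mx k 0); split; first by rewrite mul1mx -colE.
    by move=> l; rewrite !mxE andbT; case: eqP => [->|] //; rewrite !mul0r.
  by left=> l; rewrite mxE andbT; case: (l == k).
(* The action of [S j] on the coroot. *)
pose z' : 'cV[int]_n := z - (\sum_l Cm l j * z l 0) *: delta_mx j 0.
exists (scoord j c), z'.
have cN : bform (Q (Cm *m c)) (Q (Cm *m c)) = 2 * (d k)%:~R.
  by rewrite -gE !map_mxM bform_Weyl // bform_alpha_alpha.
have cz' l : scoord j c l 0 * d l = z' l 0 * d k.
  have [->|lj] := eqVneq l j; last by rewrite scoord_neq // cz !mxE (negPf lj) mulr0 subr0.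
  rewrite scoord_eq mulrBl cz !mxE !eqxx mulr1 mulrBl; congr (_ - _).
  rewrite !big_distrl; apply: eq_bigr => m _ /=.
  transitivity (d j * Cm j m * c m 0); first by ring.
  rewrite d_sym; transitivity (Cm m j * (c m 0 * d m)); first by ring.
  by rewrite cz; ring.
split=> //; first by rewrite -mulmxA gE scoordE.
case: csgn => c0; first exact: scoord_sign c0 cz' cN.
have sN : scoord j (- c) = - scoord j c.
  by rewrite /scoord mulmxN !mxE scaleNr opprB opprK addrC.
have [] := @scoord_sign j (- c) (- z') k.
- by move=> l; rewrite mxE oppr_ge0.
- by move=> l; rewrite sN [(- scoord _ _) _ _]mxE [(- z') _ _]mxE !mulNr cz'.
- by rewrite mulmxN map_mxN -scaleN1r bformZl bformZr cN; ring.
- by move=> h; right=> l; have := h l; rewrite sN mxE oppr_ge0.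
- by move=> h; left=> l; have := h l; rewrite sN mxE oppr_le0.
Qed.

Lemma rootlat0 : rootlat_ge0 0.
Proof. by exists 0; rewrite ?mulmx0 // => i; rewrite mxE. Qed.

Lemma rootlatD b b' : rootlat_ge0 b -> rootlat_ge0 b' -> rootlat_ge0 (b + b').
Proof.
move=> [c c0 ->] [c' c0' ->]; exists (c + c'); last by rewrite mulmxDr.
by move=> i; rewrite mxE addr_ge0.
Qed.

Lemma rootlatZ a b : 0 <= a -> rootlat_ge0 b -> rootlat_ge0 (a *: b).
Proof.
move=> a0 [c c0 ->]; exists (a *: c); last by rewrite scalemxAr.
by move=> i; rewrite mxE mulr_ge0.
Qed.

Lemma rootlat_sum (I : finType) (P : pred I) (F : I -> 'cV[int]_n) :
  (forall i, P i -> rootlat_ge0 (F i)) -> rootlat_ge0 (\sum_(i | P i) F i).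
Proof. by move=> h; apply: big_ind => //; [apply: rootlat0 | apply: rootlatD]. Qed.

Lemma rootlat_anti b : rootlat_ge0 b -> rootlat_ge0 (- b) -> b = 0.
Proof.
move=> [c c0 ->] [c' c0' e]; suff -> : c = 0 by rewrite mulmx0.
have cE : c' = - c by apply: Cm_inj; rewrite /= -e mulmxN.
apply/colP=> i; apply/eqP; rewrite mxE eq_le c0 andbT.
by have := c0' i; rewrite cE mxE oppr_ge0.
Qed.

Lemma root_pm b : root b -> rootlat_ge0 b \/ rootlat_ge0 (- b).
Proof.
move=> [g [k [Wg ->]]]; have [c [z [-> _ [h|h]]]] := root_coords k Wg; first by left; exists c.
by right; exists (- c); rewrite ?mulmxN // => i; rewrite mxE oppr_ge0.
Qed.

Lemma alpha_neq0 i : al i != 0.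
Proof. by apply/eqP=> /colP/(_ i); rewrite !mxE Cm_diag. Qed.

Lemma rootlat_alpha i : rootlat_ge0 (al i).
Proof.
exists (delta_mx i 0); last by rewrite -colE.
by move=> l; rewrite mxE; case: eqP.
Qed.

Lemma root_neq0 b : root b -> b != 0.
Proof.
move=> [g [k [Wg ->]]]; apply/eqP=> e; have /eqP[] := alpha_neq0 k.
by rewrite -(mulKmx (Weyl_unit Wg) (al k)) e mulmx0.
Qed.

(** * Exchange and dominant weights *)

Lemma reflection_conj g i j : W g -> g *m al i = al j -> g *m S i = S j *m g.
Proof.
move=> Wg e; have dE : (d i)%:~R = (d j)%:~R :> rat.
  by apply: (@mulfI _ 2) => //; rewrite -!bform_alpha_alpha -e map_mxM bform_Weyl.
have dj : (d j)%:~R != 0 :> rat by rewrite intr_eq0 gt_eqF.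
suff h l : g *m S i *m l = S j *m g *m l :> 'cV[int]_n.
  apply/matrixP=> r c; have /colP/(_ r) := h (delta_mx c 0).
  by rewrite -!colE !mxE.
rewrite -!mulmxA !sref_colE mulmxBr -scalemxAr e; congr (_ - _ *: _).
apply: (@intr_inj rat); apply: (mulfI dj).
have := bform_Weyl (Q l) (Q (al i)) Wg.
by rewrite -!map_mxM e !bform_alpha dE => /esym; rewrite [Q l _ _]mxE [Q (g *m l) _ _]mxE.
Qed.

(** [S k] changes only the [k]-th coordinate, so the others are both nonnegative and nonpositive.
    Then [b] is a multiple of [al k], and its coefficient and that of its coroot are mutually
    inverse integers. *)
Lemma sref_neg_root k b :
  root b -> rootlat_ge0 b -> rootlat_ge0 (- (S k *m b)) -> b = al k.
Proof.
case=> g [i [Wg bE]] [c c0 cE] [c' c0' /(congr1 -%R)].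
rewrite opprK -mulmxN cE -scoordE => /Cm_inj c'E.
have cl l : l != k -> c l 0 = 0.
  move=> lk; apply/eqP; rewrite eq_le c0 andbT -(scoord_neq c lk) c'E mxE oppr_le0.
  exact: c0'.
have bk : Cm *m c = c k 0 *: al k.
  have -> : al k = Cm *m delta_mx k 0 by rewrite -colE.
  rewrite scalemxAr; congr (_ *m _).
  apply/colP=> l; rewrite !mxE andbT; have [->|/cl ->] := eqVneq l k; first by rewrite mulr1.
  by rewrite mulr0.
have [c1 [z [e cz _]]] := root_coords i Wg.
have c1E : c1 = c by apply: Cm_inj; rewrite /= -e -bE.
have dE : d i = c k 0 * c k 0 * d k.
  apply: (@intr_inj rat); apply: (@mulfI _ 2) => //.
  rewrite -bform_alpha_alpha -(bform_Weyl _ _ Wg) -!map_mxM -bE cE bk map_mxZ.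
  by rewrite bformZl bformZr bform_alpha_alpha !rmorphM; ring.
have zk := cz k; rewrite c1E in zk.
rewrite bk; have -> : c k 0 = 1; last by rewrite scale1r.
have e1 : (c k 0 * z k 0 - 1) * d i = 0.
  by rewrite mulrBl mul1r -mulrA -zk {1}dE; ring.
have di := d_gt0 i; have ck := c0 k.
have e2 : c k 0 * z k 0 = 1.
  by apply/eqP; rewrite -subr_eq0; move/eqP: e1; rewrite mulf_eq0 (gt_eqF di) orbF.
have z_gt0 : 0 < z k 0 by nia.
have c_gt0 : 0 < c k 0 by nia.
have c_le1 : c k 0 <= 1 by nia.
lia.
Qed.

(** The deleted letter [j] is the one at which the image of [al i] turns negative: just before, that
    image is [al j], so [reflection_conj] replaces [S i] on the right by [S j] on the left, which
    cancels the letter. *)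
Lemma exchange s i : rootlat_ge0 (- (word s *m al i)) ->
  exists2 t, (size t < size s)%N & word t = word s *m S i.
Proof.
elim: s => [|j s IH] /=.
  rewrite mul1mx => h; have /eqP[] := alpha_neq0 i.
  by apply: rootlat_anti h; apply: rootlat_alpha.
move=> h; have Ws : W (word s) by exists s.
have rs : root (word s *m al i) by exists (word s), i.
have [b0|/IH[t st tE]] := root_pm rs; last by exists (j :: t); rewrite //= tE mulmxA.
exists s => //; rewrite -mulmxA in h.
rewrite -mulmxA (@reflection_conj _ i j) ?mulmxA ?sref_invol ?mul1mx //.
exact: sref_neg_root h.
Qed.

Definition dominant (l : 'cV[int]_n) : Prop := forall i, 0 <= l i 0.

(* Induction on the length of a word for [w]: removing its last letter changes
   [w l] by a nonnegative multiple of a root, and [exchange] shortens the word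
   when that root is negative. *)
Lemma dominant_sub_Weyl w l : W w -> dominant l -> rootlat_ge0 (l - w *m l).
Proof.
move=> [s ->] ldom; rewrite -/(word s).
have [m] := ubnP (size s); elim: m => // m IH in s *.
case/lastP: s => [|s i]; first by rewrite /= mul1mx subrr => _; apply: rootlat0.
rewrite size_rcons ltnS => sm; rewrite word_rcons.
have Ws : W (word s) by exists s.
have rt : root (word s *m al i) by exists (word s), i.
case: (root_pm rt) => b0.
  rewrite -mulmxA sref_colE mulmxBr opprB addrCA addrC -scalemxAr.
  by apply: rootlatD; [exact: IH | exact: rootlatZ].
have [t st <-] := exchange b0; apply: IH; exact: leq_trans st (ltnW sm).
Qed.

Lemma dominant_le0 l : dominant l -> rootlat_ge0 (- l) -> l = 0.
Proof.
move=> ldom [c c0 e]; apply/eqP; apply: contraT => l0.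
have : 0 < bform (Q l) (Q l).
  apply: bform_gt0; apply: contra l0 => /eqP/colP h; apply/eqP/colP=> i.
  by move: (h i); rewrite !mxE => /eqP; rewrite intr_eq0 => /eqP.
have lE : Q l = Q Cm *m (Q (- c)) by rewrite -map_mxM mulmxN -e opprK.
rewrite {2}lE bform_Cm ltNge sumr_le0 // => i _.
by rewrite !mxE -!rmorphM lerz0 mulrN oppr_le0 mulr_ge0 // mulr_ge0 // ltW.
Qed.

(** * Finiteness of the Weyl group *)

Lemma Weyl_entry_bound : exists N : nat, forall g, W g -> forall i k, `|g i k| <= N%:Z.
Proof.
(* The form pairs the image of varpi_k under [g] with [al i] to [d i * g i k]; Cauchy-Schwarz and
   invariance bound the square. *)
pose B i k := bform (delta_mx k 0) (delta_mx k 0) * (2 / (d i)%:~R).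
exists (\sum_i \sum_k Num.bound (B i k))%N => g Wg i k.
have Bik : (Num.bound (B i k) <= \sum_i \sum_k Num.bound (B i k))%N.
  by rewrite (bigD1 i) //= (bigD1 k) //= -addnA leq_addr.
apply: le_trans (_ : (Num.bound (B i k))%:Z <= _); last by rewrite lez_nat.
have d0 : 0 < (d i)%:~R :> rat by rewrite ltr0z.
have := bform_CS (Q g *m delta_mx k 0) (Q (al i)).
rewrite bform_Weyl // bform_alpha_alpha bform_alpha -colE !mxE => h.
have sq : ((g i k)%:~R : rat) ^+ 2 <= B i k.
  rewrite /B mulrA ler_pdivlMr // -(ler_pM2r d0).
  apply: le_trans (le_trans _ h) _; rewrite ?exprMn /B le_eqVlt; apply/orP; left;
    by apply/eqP; ring.
have Bpos : 0 <= B i k by apply: le_trans sq; rewrite sqr_ge0.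
have := le_lt_trans sq (archi_boundP Bpos).
rewrite -rmorphXn /= pmulrn ltr_int => h2.
apply: ltW; apply: le_lt_trans h2.
rewrite -[X in _ <= X]ger0_norm ?sqr_ge0 // normrX.
have := normr_ge0 (g i k); set x := `|g i k|; nia.
Qed.

Lemma Weyl_finite : exists ws : seq 'M[int]_n, uniq ws /\ forall g, (g \in ws) <-> W g.
Proof.
have [N hN] := Weyl_entry_bound.
(* Entries lie between [-N] and [N]; the shift by [N] makes them natural numbers at most [2 * N]. *)
pose phi (g : 'M[int]_n) : {ffun 'I_n * 'I_n -> 'I_(2 * N).+1} :=
  [ffun p : 'I_n * 'I_n => inord `|(g p.1 p.2 + N%:Z)%R|%N].
apply: (@finite_of_injective _ _ _ phi) => g h Wg Wh /ffunP e.
apply/matrixP=> i k; have := e (i, k); rewrite !ffunE /=.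
move=> /(congr1 val) /=; have := hN g Wg i k; have := hN h Wh i k => h1 h2.
rewrite !inordK; lia.
Qed.

(** * Evaluation of characters *)

Lemma char_evalD (l l' : 'cV[int]_n) u : torus u ->
  char_eval (l + l') u = char_eval l u * char_eval l' u.
Proof.
move=> tu; rewrite /char_eval -big_split; apply: eq_bigr => k _.
by rewrite mxE expfzDr.
Qed.

Lemma char_eval0 u : char_eval (0 : 'cV[int]_n) u = 1.
Proof. by rewrite /char_eval big1 // => k _; rewrite mxE expr0z. Qed.

Lemma char_evalZ a (l : 'cV[int]_n) u : char_eval (a *: l) u = char_eval l u ^ a.
Proof.
rewrite /char_eval (big_morph (fun x => x ^ a) (id1 := 1) (op1 := *%R)).
- by apply: eq_bigr => k _; rewrite exprz_exp mxE mulrC.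
- by move=> x y; rewrite expfzMl.
- by rewrite exp1rz.
Qed.

Lemma char_evalN (l : 'cV[int]_n) u : char_eval (- l) u = (char_eval l u)^-1.
Proof. by rewrite -scaleN1r char_evalZ exprN1. Qed.

Lemma char_eval_neq0 (l : 'cV[int]_n) u : torus u -> char_eval l u != 0.
Proof. by move=> tu; apply/prodf_neq0 => k _; apply: expfz_neq0. Qed.

Lemma char_eval_sum (I : finType) (P : pred I) (F : I -> 'cV[int]_n) u : torus u ->
  char_eval (\sum_(i | P i) F i) u = \prod_(i | P i) char_eval (F i) u.
Proof.
move=> tu; apply: (big_morph (fun l => char_eval l u)); last exact: char_eval0.
by move=> l l'; apply: char_evalD.
Qed.

Lemma col_sum_fweight (l : 'cV[int]_n) : l = \sum_k l k 0 *: fweight k.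
Proof.
rewrite [LHS]matrix_sum_delta; apply: eq_bigr => k _.
by rewrite big_ord1.
Qed.

Lemma char_eval_fweight k u : char_eval (fweight k : 'cV[int]_n) u = u k.
Proof.
rewrite /char_eval (bigD1 k) //= big1 ?mulr1 => [|j jk].
  by rewrite mxE !eqxx expr1z.
by rewrite mxE (negPf jk) expr0z.
Qed.

Lemma char_eval_tact (g : 'M[int]_n) l u : torus u ->
  char_eval l (tact g u) = char_eval (invmx g *m l) u.
Proof.
move=> tu; rewrite [l in RHS]col_sum_fweight mulmx_sumr char_eval_sum //.
by apply: eq_bigr => k _; rewrite -scalemxAr char_evalZ.
Qed.

Lemma char_evalM (l : 'cV[int]_n) x u :
  char_eval l (fun k => x k * u k) = char_eval l x * char_eval l u.
Proof.
by rewrite /char_eval -big_split; apply: eq_bigr => k _; rewrite expfzMl.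
Qed.

Lemma center_Weyl x g l : center Cm x -> W g ->
  char_eval (g *m l) x = char_eval l x.
Proof.
move=> [tx x1]; move: g.
apply: (Weyl_ind (P := fun g => char_eval (g *m l) x = char_eval l x)) => [|i g _ IH].
  by rewrite mul1mx.
rewrite -mulmxA sref_colE char_evalD // -scaleNr char_evalZ.
by rewrite (x1 _ (root_alpha i)) exp1rz mulr1.
Qed.

(** * Antisymmetric sums of characters *)

Definition rho : 'cV[int]_n := const_mx 1.

(** Rational, because a weight is in general only a rational combination of simple roots. *)
Definition height (b : 'cV[int]_n) : rat := \sum_k (invmx (Q Cm) *m Q b) k 0.

Lemma heightB_alpha b a i : height (b - a *: al i) = height b - a%:~R.
Proof.
rewrite /height map_mxB mulmxBr map_mxZ -scalemxAr Q_alpha mulKmx ?CmQ_unit //.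
move: (invmx _ *m Q b) => y.
under eq_bigr => k _ do rewrite !mxE andbT.
rewrite sumrB; congr (_ - _); rewrite (bigD1 i) //= eqxx mulr1 big1 ?addr0 //.
by move=> k /negPf ->; rewrite mulr0.
Qed.

(* A nonzero coefficient of maximal height sits at a weight that is dominant
   and, by antisymmetry, regular; being [<= rho], it is [rho]. *)
Lemma antisym_sum_eq0 (I : finType) (om : I -> 'cV[int]_n) (a : I -> int) :
  (forall k l, \sum_(i | om i == S k *m l) a i = - \sum_(i | om i == l) a i) ->
  (forall i, rootlat_ge0 (rho - om i)) -> \sum_(i | om i == rho) a i = 0 ->
  forall u, \sum_i (a i)%:~R * char_eval (om i) u = 0.
Proof.
move=> anti le_rho a_rho u.
pose p l := \sum_(i | om i == l) a i.
have pS k l : p (S k *m l) = - p l by apply: anti.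
have in_supp l : p l != 0 -> exists i, om i = l.
  move=> pl; suff /existsP[i /eqP] : [exists i, om i == l] by exists i.
  by apply: contraNT pl => /existsPn h; rewrite /p big_pred0 // => i; apply/negbTE.
suff p0 l : p l = 0.
  rewrite (partition_big (fun i => SeqSub (codom_f om i)) xpredT) //=.
  rewrite big1 // => j _.
  rewrite (eq_bigr (fun i => (a i)%:~R * char_eval (val j) u)) => [|i /eqP <- //].
  rewrite -big_distrl -rmorph_sum /=.
  by rewrite (eq_bigl (fun i => om i == val j)) // -/(p _) p0 mul0r.
apply/eqP; apply: contraT => pl; have [i0 i0E] := in_supp _ pl.
rewrite -i0E in pl.
have [i pi i_max] := arg_maxP (P := fun i => p (om i) != 0) (fun i => height (om i)) pl.
have dom k : 1 <= om i k 0.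
  have pk : p (S k *m om i) != 0 by rewrite pS oppr_eq0.
  have [j jE] := in_supp _ pk.
  have := i_max j; rewrite jE pk => /(_ isT) /=.
  rewrite sref_colE heightB_alpha gerBl ler0z le_eqVlt => /orP[/eqP e|//].
  have /eqP := pS k (om i); rewrite sref_colE -e scale0r subr0.
  by rewrite -addr_eq0 -mulr2n mulrn_eq0 (negPf pi).
have /eqP : om i - rho = 0.
  apply: dominant_le0; last by rewrite opprB.
  by move=> k; rewrite !mxE subr_ge0.
by rewrite subr_eq0 => /eqP e; move: pi; rewrite e /p a_rho.
Qed.

Lemma positive_roots_finite : exists ps : seq 'cV[int]_n,
  forall b, (b \in ps) <-> root b /\ rootlat_ge0 b.
Proof.
have [ws [_ wsP]] := Weyl_finite.
exists [seq b <- flatten [seq [seq w *m al i | i <- enum 'I_n] | w <- ws] | `[< rootlat_ge0 b >]].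
move=> b; rewrite mem_filter; split.
  case/andP=> /asboolP b0 /flatten_mapP[w /wsP Ww /mapP[i _ bE]].
  by split=> //; exists w, i.
case=> [[w [i [Ww bE]]] b0]; apply/andP; split; first exact/asboolP.
apply/flatten_mapP; exists w; first exact/wsP.
by apply/mapP; exists i; rewrite ?mem_enum.
Qed.

Variables (ws : seq 'M[int]_n) (ps : seq 'cV[int]_n).
Hypothesis wsP : forall g, (g \in ws) <-> W g.
Hypothesis psP : forall b, (b \in ps) <-> root b /\ rootlat_ge0 b.

Local Notation Wt := (seq_sub ws).
Local Notation Pt := (seq_sub ps).

Lemma Wt_Weyl (w : Wt) : W (val w).
Proof. by apply/wsP; apply: valP. Qed.

(** For [g] in W the default value of [insubd] is never taken. *)
Definition wmul (g : 'M[int]_n) (w : Wt) : Wt := insubd w (g *m val w).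

Lemma val_wmul g w : W g -> val (wmul g w) = g *m val w.
Proof.
by move=> Wg; apply: insubdK; apply/wsP/WeylM => //; apply: Wt_Weyl.
Qed.

Lemma wmul_inj g : W g -> injective (wmul g).
Proof.
move=> Wg v w /(congr1 val); rewrite !val_wmul //.
by move/(can_inj (mulKmx (Weyl_unit Wg)))/val_inj.
Qed.

(** * The Weyl denominator *)

(** Expanding the Weyl denominator gives one term per set [J] of positive roots. The terms are kept
    without cancellation, so that antisymmetry becomes an involution on the sets. *)
Definition den_weight (J : {set Pt}) : 'cV[int]_n :=
  rho - \sum_b (if b \in J then val b else 0).
Definition den_sign (J : {set Pt}) : int := \prod_(b : Pt) (if b \in J then -1 else 1).

Lemma den_sumE u : torus u ->
  \sum_J (den_sign J)%:~R * char_eval (den_weight J) u =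
  char_eval rho u * \prod_(b : Pt) (1 - (char_eval (val b) u)^-1).
Proof.
move=> tu; under [X in _ * X]eq_bigr => b _ do rewrite addrC.
rewrite bigA_distr big_distrr /=; apply: eq_big => [J|J _]; first by rewrite inE.
rewrite /den_weight char_evalD // mulrCA; congr (_ * _).
rewrite char_evalN char_eval_sum // -prodfV rmorph_prod -big_split /=.
apply: eq_bigr => b _; case: ifP => _; first by rewrite mulN1r.
by rewrite char_eval0 invr1 mulr1.
Qed.

Lemma alpha_pos k : al k \in ps.
Proof. by apply/psP; split; [apply: root_alpha | apply: rootlat_alpha]. Qed.

Definition apos k : Pt := SeqSub (alpha_pos k).

(** [S k] permutes the positive roots other than [al k]; it is completed by fixing [al k]. *)
Definition sperm (k : 'I_n) (b : Pt) : Pt :=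
  if b == apos k then b else insubd b (S k *m val b).

Lemma val_sperm k b : b != apos k -> val (sperm k b) = S k *m val b.
Proof.
move=> bk; rewrite /sperm (negPf bk); apply: insubdK; apply/psP.
have [rb b0] := (psP (val b)).1 (valP b).
have rs : root (S k *m val b) by apply: root_Weyl => //; apply: Weyl_sref.
split=> //; case: (root_pm rs) => // sN.
move: bk; rewrite -val_eqE /= => /eqP[]; exact: sref_neg_root sN.
Qed.

Lemma sperm_apos k : sperm k (apos k) = apos k.
Proof. by rewrite /sperm eqxx. Qed.

Lemma spermK k : involutive (sperm k).
Proof.
move=> b; have [->|bk] := eqVneq b (apos k); first by rewrite !sperm_apos.
have sk : sperm k b != apos k.
  apply/eqP => /(congr1 val); rewrite val_sperm //= => e.
  have [rb b0] := (psP (val b)).1 (valP b).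
  have bE : val b = - al k.
    by rewrite -(mul1mx (val b)) -(sref_invol k) -mulmxA e sref_alpha.
  have := rootlat_anti b0; rewrite {1}bE opprK => /(_ (rootlat_alpha k))/eqP.
  by rewrite (negPf (root_neq0 rb)).
apply: val_inj; rewrite /= !val_sperm // mulmxA sref_invol mul1mx //.
Qed.

(** Since [S k] sends [rho] to [rho - al k] and negates [al k], membership of [al k] is toggled
    while the other roots are permuted. The toggle also reverses the sign. *)
Definition den_flip (k : 'I_n) (J : {set Pt}) : {set Pt} :=
  [set b | (sperm k b \in J) (+) (b == apos k)].

Lemma den_flipK k : involutive (den_flip k).
Proof.
move=> J; apply/setP=> b; rewrite !inE spermK.
have -> : (sperm k b == apos k) = (b == apos k).
  by rewrite -{1}(sperm_apos k) (inj_eq (can_inj (spermK k))).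
by rewrite -addbA addbb addbF.
Qed.

Lemma in_den_flip k J b : b != apos k -> (b \in den_flip k J) = (sperm k b \in J).
Proof. by move=> bk; rewrite inE (negPf bk) addbF. Qed.

Lemma apos_den_flip k J : (apos k \in den_flip k J) = (apos k \notin J).
Proof. by rewrite inE sperm_apos eqxx addbT. Qed.

Lemma sperm_neq k b : (sperm k b != apos k) = (b != apos k).
Proof. by rewrite -{1}(sperm_apos k) (inj_eq (can_inj (spermK k))). Qed.

Lemma den_sign_flip k J : den_sign (den_flip k J) = - den_sign J.
Proof.
rewrite /den_sign (bigD1 (apos k)) //= [in RHS](bigD1 (apos k)) //= apos_den_flip.
rewrite [in RHS](reindex_inj (can_inj (spermK k))) /=.
rewrite [in RHS](eq_bigl _ _ (sperm_neq k)).
rewrite (eq_bigr (fun b => if sperm k b \in J then -1 else 1)) => [|b bk]; last first.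
  by rewrite in_den_flip.
by case: (_ \in J); rewrite /= ?mulN1r ?mul1r ?opprK.
Qed.

Lemma den_weight_flip k J : den_weight (den_flip k J) = S k *m den_weight J.
Proof.
rewrite /den_weight mulmxBr mulmx_sumr.
have -> : S k *m rho = rho - al k by rewrite sref_colE mxE scale1r.
rewrite -addrA -opprD; congr (_ - _).
rewrite (bigD1 (apos k)) //= [in RHS](bigD1 (apos k)) //= apos_den_flip.
rewrite [in RHS](reindex_inj (can_inj (spermK k))) /=.
rewrite [in RHS](eq_bigl _ _ (sperm_neq k)) addrA.
rewrite (eq_bigr (fun b => S k *m (if sperm k b \in J then val (sperm k b) else 0)))
  => [|b bk]; last first.
  rewrite in_den_flip //; case: ifP => _; last by rewrite mulmx0.
  by rewrite -val_sperm ?sperm_neq // spermK.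
congr (_ + _); case: (_ \in J) => /=; last by rewrite mulmx0 addr0.
by rewrite sref_alpha subrr.
Qed.

Lemma den_weight_rho : \sum_(J | den_weight J == rho) den_sign J = 1.
Proof.
rewrite (big_pred1 set0) => [|J]; first by rewrite /den_sign big1 // => b _; rewrite inE.
rewrite /den_weight -[X in _ == X]subr0 (inj_eq (addrI _)) eqr_opp.
apply/eqP/eqP => [e|->]; last by rewrite big1 // => b _; rewrite inE.
apply/setP=> b; rewrite inE; apply/negP=> bJ.
have [rb b0] := (psP (val b)).1 (valP b).
have /eqP := root_neq0 rb; apply; apply: (rootlat_anti b0).
move: e; rewrite (bigD1 b) //= bJ => /eqP; rewrite addrC addr_eq0 => /eqP <-.
apply: rootlat_sum => c _; case: ifP => _; last exact: rootlat0.
by have [] := (psP (val c)).1 (valP c).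
Qed.

Lemma den_weight_le J : rootlat_ge0 (rho - den_weight J).
Proof.
rewrite /den_weight opprB addrCA subrr addr0.
apply: rootlat_sum => c _; case: ifP => _; last exact: rootlat0.
by have [] := (psP (val c)).1 (valP c).
Qed.

(** * The Jacobian of the fundamental orbit sums *)

(* Up to a positive factor, row [i] is the logarithmic differential at [u] of the
   orbit sum of the [i]-th fundamental weight. *)
Definition jac (u : 'I_n -> CC) : 'M[CC]_n := \matrix_(i, j)
  \sum_(w : Wt) ((val w *m fweight i) j 0)%:~R * char_eval (val w *m fweight i) u.

(** Multilinear expansion of [jac] by rows: [f] chooses one orbit element per row, the chosen
    characters multiply to weight [jac_weight f], and the coefficient is [\det (jac_mx f)]. *)
Definition jac_weight (f : {ffun 'I_n -> Wt}) : 'cV[int]_n :=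
  \sum_i val (f i) *m fweight i.
Definition jac_mx (f : {ffun 'I_n -> Wt}) : 'M[int]_n :=
  \matrix_(i, j) (val (f i) *m fweight i) j 0.

Lemma jac_detE u : torus u ->
  \det (jac u) = \sum_f (\det (jac_mx f))%:~R * char_eval (jac_weight f) u.
Proof.
move=> tu; rewrite /determinant.
under eq_bigr => s _.
  under eq_bigr => i _ do rewrite mxE.
  rewrite bigA_distr_bigA big_distrr /=.
  over.
rewrite exchange_big /=; apply: eq_bigr => f _.
rewrite rmorph_sum big_distrl /=; apply: eq_bigr => s _.
rewrite rmorphM rmorph_sign -mulrA; congr (_ * _).
rewrite rmorph_prod char_eval_sum // -big_split; apply: eq_bigr => i _ /=.
by rewrite [jac_mx _ _ _]mxE.
Qed.

(** Factoring the block matrix [B] in two ways gives det(1 - al k v) = 1 - v al k, which is 1 -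
    2. *)
Lemma det_sref k : \det (S k) = -1.
Proof.
pose v : 'rV[int]_n := delta_mx 0 k.
pose B : 'M[int]_(1 + n) := block_mx 1%:M v (al k) 1%:M.
have B1 : B = block_mx 1%:M 0 (al k) 1%:M *m block_mx 1%:M v 0 (S k).
  rewrite mulmx_block !(mul1mx, mul0mx, mulmx0, mulmx1, addr0); congr block_mx.
  by rewrite /sref addrC subrK.
have B2 : B = block_mx (1%:M - v *m al k) v 0 1%:M *m block_mx 1%:M 0 (al k) 1%:M.
  by rewrite mulmx_block !(mul0mx, mulmx0, mulmx1, mul1mx, add0r) subrK.
have := congr1 determinant B1; rewrite B2 !det_mulmx !det_ublock !det_lblock !det1.
rewrite !mul1r !mulr1 => <-; rewrite -rowE.
have -> : row k (al k) = 2%:M by apply/matrixP=> a b; rewrite !ord1 !mxE Cm_diag.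
by rewrite det_mx11 !mxE.
Qed.

Lemma jac_weight_le f : rootlat_ge0 (rho - jac_weight f).
Proof.
have -> : rho = \sum_i fweight i.
  by rewrite [LHS]col_sum_fweight; apply: eq_bigr => i _; rewrite mxE scale1r.
rewrite -sumrB; apply: rootlat_sum => i _; apply: dominant_sub_Weyl; first exact: Wt_Weyl.
by move=> k; rewrite mxE; case: (_ && _).
Qed.

Lemma jac_antisym k l :
  \sum_(f | jac_weight f == S k *m l) \det (jac_mx f) =
  - \sum_(f | jac_weight f == l) \det (jac_mx f).
Proof.
have Wk := Weyl_sref k.
pose h (f : {ffun 'I_n -> Wt}) := [ffun i => wmul (S k) (f i)].
have h_inj : injective h.
  move=> f f' /ffunP e; apply/ffunP=> i; have := e i; rewrite !ffunE.
  exact: wmul_inj.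
rewrite (reindex_inj h_inj) -sumrN; apply: eq_big => [f|f _].
  have -> : jac_weight (h f) = S k *m jac_weight f.
    rewrite /jac_weight mulmx_sumr; apply: eq_bigr => i _.
    by rewrite ffunE val_wmul // mulmxA.
  by rewrite (inj_eq (can_inj (mulKmx (Weyl_unit Wk)))).
have -> : jac_mx (h f) = jac_mx f *m (S k)^T.
  apply/matrixP=> i j; rewrite mxE ffunE val_wmul // -mulmxA mxE [RHS]mxE.
  by apply: eq_bigr => m _; rewrite [jac_mx _ _ _]mxE [_^T _ _]mxE mulrC.
by rewrite det_mulmx det_tr det_sref mulrN1.
Qed.

(** The differences varpi_i - [f i] varpi_i are nonnegative; if they add up to 0, each vanishes and
    [jac_mx f] is the identity. So [m] counts such [f], among them the constant 1. *)
Lemma jac_weight_rho : exists2 m : nat, (0 < m)%N &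
  \sum_(f | jac_weight f == rho) \det (jac_mx f) = m%:Z.
Proof.
have one_in : 1%:M \in ws by apply/wsP; apply: Weyl1.
exists #|[pred f | jac_weight f == rho]|.
  apply/card_gt0P; exists [ffun => SeqSub one_in]; rewrite inE; apply/eqP.
  rewrite [RHS]col_sum_fweight; apply: eq_bigr => i _.
  by rewrite ffunE mxE scale1r mul1mx.
rewrite (eq_bigr (fun => 1)) => [|f /eqP fE]; first by rewrite sumr_const natz.
suff -> : jac_mx f = 1%:M by rewrite det1.
apply/matrixP=> i j; rewrite mxE.
suff -> : val (f i) *m fweight i = fweight i by rewrite !mxE andbT eq_sym.
have le_i i' : rootlat_ge0 (fweight i' - val (f i') *m fweight i').
  apply: dominant_sub_Weyl; first exact: Wt_Weyl.
  by move=> k; rewrite mxE; case: (_ && _).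
apply/esym/eqP; rewrite -subr_eq0; apply/eqP/(rootlat_anti (le_i i)).
have : \sum_i (fweight i - val (f i) *m fweight i) = 0.
  rewrite sumrB -/(jac_weight f) fE [rho]col_sum_fweight -sumrB big1 // => k _.
  by rewrite mxE scale1r subrr.
rewrite (bigD1 i) //= => /eqP; rewrite addrC addr_eq0 => /eqP <-.
by apply: rootlat_sum.
Qed.

(* Both sides are antisymmetric, with weights [<= rho]. *)
Lemma jac_det_den : exists2 m : nat, (0 < m)%N & forall u, torus u ->
  \det (jac u) =
    m%:R * (char_eval rho u * \prod_(b : Pt) (1 - (char_eval (val b) u)^-1)).
Proof.
have [m m_gt0 mE] := jac_weight_rho; exists m => // u tu.
rewrite -den_sumE // jac_detE //; apply/eqP; rewrite -subr_eq0 big_distrr -sumrN.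
(* The difference of the two expansions, indexed by a disjoint union, is a single antisymmetric sum;
   its coefficient at [rho] is [m - m * 1]. *)
pose om (i : {ffun 'I_n -> Wt} + {set Pt}) :=
  match i with inl f => jac_weight f | inr J => den_weight J end.
pose a (i : {ffun 'I_n -> Wt} + {set Pt}) : int :=
  match i with inl f => \det (jac_mx f) | inr J => - (m%:Z * den_sign J) end.
have := @antisym_sum_eq0 _ om a; rewrite /om /a => h.
apply/eqP; rewrite -[RHS](h _ _ _ u) ?big_sumType /=.
- congr (_ + _); apply: eq_bigr => J _.
  by rewrite rmorphN rmorphM mulNr mulrA.
- move=> k l; rewrite !big_sumType /= jac_antisym opprD; congr (_ + _).
  rewrite (reindex_inj (can_inj (den_flipK k))) -sumrN; apply: eq_big => J.
    by rewrite den_weight_flip (inj_eq (can_inj (mulKmx (Weyl_unit (Weyl_sref k))))).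
  by rewrite den_sign_flip mulrN.
- by case=> [f|J]; [apply: jac_weight_le | apply: den_weight_le].
- by rewrite mE sumrN -big_distrr /= den_weight_rho mulr1 subrr.
Qed.

Lemma jac_unit u : torus u -> regular Cm u -> jac u \in unitmx.
Proof.
move=> tu ru; have [m m_gt0 mE] := jac_det_den.
rewrite unitmxE unitfE mE // !mulf_neq0 ?char_eval_neq0 //; last first.
  apply/prodf_neq0 => b _; have [rb _] := (psP (val b)).1 (valP b).
  by rewrite subr_eq0 eq_sym invr_eq1 ru.
by rewrite pnatr_eq0 -lt0n.
Qed.

Lemma jac_tact g u : W g -> torus u ->
  jac (tact g u) = jac u *m (map_mx intr g)^T.
Proof.
move=> Wg tu; apply/matrixP=> i j; rewrite mxE [RHS]mxE (reindex_inj (wmul_inj Wg)) /=.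
under [RHS]eq_bigr => k _ do rewrite mxE big_distrl /=.
rewrite exchange_big /=; apply: eq_bigr => w _.
rewrite val_wmul // char_eval_tact // -mulmxA mulKmx ?Weyl_unit // mxE rmorph_sum big_distrl /=.
by apply: eq_bigr => k _; rewrite !mxE rmorphM /=; ring.
Qed.

Lemma jac_center x u : center Cm x ->
  jac (fun k => x k * u k) = diag_mx (\row_i char_eval (fweight i) x) *m jac u.
Proof.
move=> cx; apply/matrixP=> i j; rewrite mul_diag_mx !mxE big_distrr /=.
apply: eq_bigr => w _; rewrite char_evalM center_Weyl //; last exact: Wt_Weyl.
by rewrite mulrCA.
Qed.

Lemma eq_jac u v : u =1 v -> jac u = jac v.
Proof. by move=> /funext ->. Qed.

Lemma regular_stab g u : W g -> torus u -> regular Cm u ->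
  (forall k, tact g u k = u k) -> g = 1%:M.
Proof.
move=> Wg tu ru /eq_jac; rewrite jac_tact // => e.
have : (map_mx intr g : 'M[CC]_n)^T = 1%:M.
  by rewrite -(mulKmx (jac_unit tu ru) _^T) e mulVmx ?jac_unit.
move/(congr1 trmx); rewrite trmxK trmx1 => /matrixP e'.
apply/matrixP=> i j; have := e' i j; rewrite !mxE => /eqP.
by rewrite -[(_ == _)%:R]/((i == j)%:R : CC) -(mulrz_nat (i == j)) eqr_int => /eqP ->; rewrite natz.
Qed.

(** [jac u] conjugates the transpose of [g] to [D]. As [lie_act g] is the inverse of that transpose,
    the inverses of the varpi_i(x) appear. *)
Lemma char_poly_lie_act g u x : W g -> torus u -> regular Cm u -> center Cm x ->
  (forall k, tact g u k = x k * u k) ->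
  char_poly (lie_act g) = \prod_(i < n) ('X - ((char_eval (fweight i) x)^-1)%:P).
Proof.
move=> Wg tu ru cx /eq_jac; rewrite jac_tact // jac_center //.
have Ju := jac_unit tu ru; set D := diag_mx _ => e.
have tx : torus x by case: cx.
pose D' : 'M[CC]_n := diag_mx (\row_i (char_eval (fweight i) x)^-1).
have DD : D' *m D = 1%:M.
  apply/matrixP=> i j; rewrite mul_diag_mx !mxE; case: eqP => [->|] //=; last by rewrite mulr0.
  by rewrite mulVf ?char_eval_neq0.
have gl : (map_mx intr g : 'M[CC]_n)^T *m lie_act g = 1%:M.
  rewrite /lie_act /dual_mx map_trmx -map_mxM -trmx_mul mulVmx ?Weyl_unit //.
  by rewrite trmx1 map_mx1.
have lE : lie_act g = invmx (jac u) *m D' *m jac u.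
  apply: (can_inj (mulKmx Ju)); rewrite !mulmxA mulmxV // mul1mx.
  by rewrite -[jac u in RHS]mulmx1 -gl !mulmxA -(mulmxA D') e !mulmxA DD mul1mx.
have -> : \prod_(i < n) ('X - ((char_eval (fweight i) x)^-1)%:P) = char_poly D'.
  rewrite char_poly_trig ?diag_mx_is_trig //; apply: eq_bigr => i _.
  by rewrite !mxE eqxx.
rewrite /char_poly /char_poly_mx lE !map_mxM; set r := RHS.
have Vu : map_mx polyC (invmx (jac u)) *m map_mx polyC (jac u) = 1%:M.
  by rewrite -map_mxM mulVmx // map_mx1.
have -> : 'X%:M = map_mx polyC (invmx (jac u)) *m 'X%:M *m map_mx polyC (jac u).
  by rewrite scalar_mxC -mulmxA Vu mulmx1.
rewrite -mulmxBl -mulmxBr !det_mulmx mulrAC -det_mulmx Vu det1 mul1r.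
by [].
Qed.

(** * Alcoves *)

Section Alcove.
Variable F : archiRealFieldType.
Implicit Types (l : 'cV[int]_n) (v x y : 'cV[F]_n).

Definition pairing l v : F := \sum_k (l k 0)%:~R * v k 0.
Definition act (g : 'M[int]_n) v : 'cV[F]_n := map_mx intr (dual_mx g) *m v.
Definition coweight_vec v : Prop := forall i, pairing (al i) v \is a Num.int.
Definition coroot_vec v : Prop := forall k, v k 0 \is a Num.int.
(** Bounding every root treats all roots alike under W; [alcoveP] gives the agreement with the bound
    on the highest root. *)
Definition in_alcove v : Prop :=
  (forall i, 0 < pairing (al i) v) /\ (forall b, root b -> pairing b v < 1).
Definition regular_vec v : Prop := forall b, root b -> pairing b v \isn't a Num.int.

Lemma pairE l v : pairing l v = ((map_mx intr l)^T *m v) 0 0.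
Proof. by rewrite mxE; apply: eq_bigr => k _; rewrite !mxE. Qed.

Lemma pairDl l l' v : pairing (l + l') v = pairing l v + pairing l' v.
Proof. by rewrite !pairE map_mxD linearD mulmxDl mxE. Qed.

Lemma pairDr l v v' : pairing l (v + v') = pairing l v + pairing l v'.
Proof. by rewrite !pairE mulmxDr mxE. Qed.

Lemma pairZr l a v : pairing l (a *: v) = a * pairing l v.
Proof. by rewrite !pairE -scalemxAr mxE. Qed.

Lemma pairNr l v : pairing l (- v) = - pairing l v.
Proof. by rewrite -scaleN1r pairZr mulN1r. Qed.

Lemma pairNl l v : pairing (- l) v = - pairing l v.
Proof. by rewrite !pairE map_mxN linearN mulNmx mxE. Qed.

Lemma pairBr l v v' : pairing l (v - v') = pairing l v - pairing l v'.
Proof. by rewrite pairDr pairNr. Qed.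

Lemma pair0r l : pairing l 0 = 0.
Proof. by rewrite pairE mulmx0 mxE. Qed.

Lemma pair_sumr l (I : finType) (G : I -> 'cV[F]_n) :
  pairing l (\sum_i G i) = \sum_i pairing l (G i).
Proof. by apply: big_morph; [apply: pairDr | apply: pair0r]. Qed.

Lemma pair_fweight k v : pairing (fweight k) v = v k 0.
Proof.
rewrite /pairing (bigD1 k) //= big1 => [|j jk].
  by rewrite mxE !eqxx mul1r addr0.
by rewrite mxE (negPf jk) mul0r.
Qed.

Lemma pair_Cm (c : 'cV[int]_n) v : pairing (Cm *m c) v = \sum_i (c i 0)%:~R * pairing (al i) v.
Proof.
rewrite /pairing; under [RHS]eq_bigr => i _ do rewrite big_distrr /=.
rewrite exchange_big /=; apply: eq_bigr => k _.
rewrite mxE rmorph_sum big_distrl; apply: eq_bigr => i _ /=.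
by rewrite mxE rmorphM mulrA (mulrC (c i 0)%:~R).
Qed.

Lemma pair_act g l v : pairing l (act g v) = pairing (invmx g *m l) v.
Proof. by rewrite !pairE map_mxM trmx_mul /act /dual_mx -map_trmx mulmxA. Qed.

Lemma actD g v v' : act g (v + v') = act g v + act g v'.
Proof. exact: mulmxDr. Qed.

Lemma actN g v : act g (- v) = - act g v.
Proof. exact: mulmxN. Qed.

Lemma actB g v v' : act g (v - v') = act g v - act g v'.
Proof. by rewrite actD actN. Qed.

Lemma actZ g a v : act g (a *: v) = a *: act g v.
Proof. by rewrite /act scalemxAr. Qed.

Lemma act_sum g (I : finType) (G : I -> 'cV[F]_n) : act g (\sum_i G i) = \sum_i act g (G i).
Proof. exact: mulmx_sumr. Qed.

Lemma act1 v : act 1%:M v = v.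
Proof. by rewrite /act /dual_mx invmx1 trmx1 map_mx1 mul1mx. Qed.

Lemma actM g h v : W g -> W h -> act (g *m h) v = act g (act h v).
Proof.
move=> Wg Wh; rewrite /act mulmxA -map_mxM; congr (map_mx _ _ *m _).
rewrite /dual_mx -trmx_mul; congr (_^T).
have Wgh := Weyl_unit (WeylM Wg Wh).
apply: (can_inj (mulmxK Wgh)); rewrite mulVmx // mulmxA -(mulmxA (invmx h)).
by rewrite mulVmx ?Weyl_unit // mulmx1 mulVmx ?Weyl_unit.
Qed.

Lemma actK g v : W g -> act g (act (invmx g) v) = v.
Proof. by move=> Wg; rewrite -actM //; [rewrite mulmxV ?Weyl_unit // act1 | apply: Weyl_inv]. Qed.

Lemma actVK g v : W g -> act (invmx g) (act g v) = v.
Proof. by move=> Wg; rewrite -actM //; [rewrite mulVmx ?Weyl_unit // act1 | apply: Weyl_inv]. Qed.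

Lemma sref_inv i : invmx (S i) = S i.
Proof.
have u := Weyl_unit (Weyl_sref i).
by rewrite -[LHS]mulmx1 -(sref_invol i) mulmxA mulVmx ?mul1mx.
Qed.

Lemma act_sref i v : act (S i) v = v - pairing (al i) v *: delta_mx i 0.
Proof.
apply/colP=> k; rewrite -pair_fweight pair_act sref_inv.
have -> : S i *m fweight k = if i == k then fweight k - al i else fweight k.
  by rewrite sref_colE mxE andbT; case: eqP => _; rewrite ?scale1r ?scale0r ?subr0.
rewrite [RHS]mxE [X in _ = _ + X]mxE [X in _ = _ - X]mxE [delta_mx _ _ _ _]mxE andbT eq_sym.
by case: (k == i); rewrite ?pairDl ?pairNl pair_fweight ?mulr1 ?mulr0 ?subr0.
Qed.

Lemma CmF_unit : (map_mx intr Cm : 'M[F]_n) \in unitmx.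
Proof.
have := CmQ_unit; rewrite !unitmxE !unitfE !det_map_mx !intr_eq0.
by [].
Qed.

Lemma pair_alpha_inj v : (forall i, pairing (al i) v = 0) -> v = 0.
Proof.
move=> h; have tu : (map_mx intr Cm : 'M[F]_n)^T \in unitmx by rewrite unitmx_tr CmF_unit.
apply: (can_inj (mulKmx tu)); rewrite mulmx0; apply/colP=> i.
rewrite mxE [RHS]mxE -[RHS](h i); apply: eq_bigr => k _.
by rewrite !mxE.
Qed.

Lemma pair_root_int b v : coweight_vec v -> root b -> pairing b v \is a Num.int.
Proof.
move=> cv [g [k [Wg ->]]]; have [c [z [-> _ _]]] := root_coords k Wg.
by rewrite pair_Cm rpred_sum // => i _; rewrite rpredM ?intr_int.
Qed.

Lemma pair_coroot_int l v : coroot_vec v -> pairing l v \is a Num.int.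
Proof. by move=> cv; rewrite rpred_sum // => i _; rewrite rpredM ?intr_int. Qed.

Lemma coroot_coweight v : coroot_vec v -> coweight_vec v.
Proof. by move=> cv i; apply: pair_coroot_int. Qed.

Lemma coweightD v v' : coweight_vec v -> coweight_vec v' -> coweight_vec (v + v').
Proof. by move=> c c' i; rewrite pairDr rpredD. Qed.

Lemma coweight_act g v : W g -> coweight_vec v -> coweight_vec (act g v).
Proof.
move=> Wg cv i; rewrite pair_act; apply: pair_root_int => //.
by apply: root_Weyl; [apply: Weyl_inv | apply: root_alpha].
Qed.

Lemma coroot_act g v : coroot_vec v -> coroot_vec (act g v).
Proof. by move=> cv k; rewrite -pair_fweight pair_act; apply: pair_coroot_int. Qed.

Lemma corootD v v' : coroot_vec v -> coroot_vec v' -> coroot_vec (v + v').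
Proof. by move=> c c' k; rewrite mxE rpredD. Qed.

Lemma corootN v : coroot_vec v -> coroot_vec (- v).
Proof. by move=> c k; rewrite mxE rpredN. Qed.

(** W acts trivially on P(R^vee)/Q(R^vee): a simple reflection subtracts an integral multiple of a
    simple coroot. *)
Lemma act_coweight_sub g v : W g -> coweight_vec v -> coroot_vec (act g v - v).
Proof.
move=> Wg cv; move: g Wg.
apply: (Weyl_ind (P := fun g => coroot_vec (act g v - v))) => [|i g Wg IH].
  by rewrite act1 subrr => k; rewrite mxE.
rewrite actM //; last exact: Weyl_sref.
rewrite act_sref addrAC; apply: corootD => // k.
have := coweight_act Wg cv i; rewrite mxE rpredN mxE => h.
apply: rpredM h _; rewrite mxE; case: (_ && _); [exact: rpred1 | exact: rpred0].
Qed.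

Lemma alcove_root_sign b : root b ->
  (forall v, in_alcove v -> 0 < pairing b v < 1) \/
  (forall v, in_alcove v -> -1 < pairing b v < 0).
Proof.
have pos b' v : root b' -> rootlat_ge0 b' -> in_alcove v -> 0 < pairing b' v < 1.
  move=> rb [c c0 cE] [v0 v1]; rewrite v1 // andbT cE pair_Cm.
  have [i ci] : exists i, c i 0 != 0.
    apply/existsP; apply: contraT => /existsPn h; have /eqP[] := root_neq0 rb.
    rewrite cE (_ : c = 0) ?mulmx0 //; apply/colP=> i; apply/eqP.
    by move: (h i); rewrite negbK mxE.
  rewrite (bigD1 i) //= ltr_pwDl //; last first.
    by apply: sumr_ge0 => j _; rewrite mulr_ge0 ?ler0z // ltW.
  by rewrite mulr_gt0 // ltr0z lt_def ci c0.
move=> rb; have [b0|b0] := root_pm rb; [left|right] => v va.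
  exact: pos.
have := pos _ _ (root_opp rb) b0 va; rewrite pairNl; lra.
Qed.

Lemma int_strict_bounds (x : F) : x \is a Num.int -> -1 < x < 1 -> x = 0.
Proof.
case/intrP=> z -> /andP[h1 h2].
have z1 : z < 1 by rewrite -(ltr_int F).
have z2 : -1 < z by rewrite -(ltr_int F) intrN.
by have -> : z = 0 by lia.
Qed.

Lemma alcove_regular v : in_alcove v -> regular_vec v.
Proof.
move=> va b rb; apply/negP=> /int_strict_bounds h.
have [/(_ v va)|/(_ v va)] := alcove_root_sign rb => /andP[h1 h2].
  have e : pairing b v = 0 by apply: h; apply/andP; split; lra.
  by rewrite e ltxx in h1.
have e : pairing b v = 0 by apply: h; apply/andP; split; lra.
by rewrite e ltxx in h2.
Qed.

(** On the image of the alcove each root takes values in one open unit interval with integral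
    endpoints, so a single point landing in the alcove decides for all. *)
Lemma alcove_preserved g nu v c : W g -> coweight_vec nu ->
  in_alcove v -> in_alcove (act g v + nu) -> in_alcove c -> in_alcove (act g c + nu).
Proof.
move=> Wg cnu va [ga ga1] ca.
have key b : root b -> (0 < pairing b (act g v + nu) -> 0 < pairing b (act g c + nu)) /\
    (pairing b (act g v + nu) < 1 -> pairing b (act g c + nu) < 1).
  move=> rb; have rg : root (invmx g *m b) by apply: root_Weyl => //; apply: Weyl_inv.
  rewrite !pairDr !pair_act; have /intrP[z ->] := pair_root_int cnu rb.
  have zN (m : int) : z%:~R < m%:~R + 1 :> F -> z%:~R <= m%:~R :> F.
    move=> h; have : z < m + 1 by rewrite -(ltr_int F) intrD.
    by rewrite ler_int; lia.
  have zP (m : int) : m%:~R < z%:~R + 1 :> F -> m%:~R <= z%:~R :> F.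
    move=> h; have : m < z + 1 by rewrite -(ltr_int F) intrD.
    by rewrite ler_int; lia.
  case: (alcove_root_sign rg) => h; have hv := h v va; have hc := h c ca; split=> hz.
  - have := zP 0; lra.
  - have := zN 0; lra.
  - have := zP 1; lra.
  - have := zN 1; lra.
split=> [i|b rb]; last exact: (key b rb).2 (ga1 b rb).
by have [h _] := key _ (root_alpha i); apply: h.
Qed.

Lemma alcove_nonempty : exists c, in_alcove c.
Proof.
have tu : (map_mx intr Cm : 'M[F]_n)^T \in unitmx by rewrite unitmx_tr CmF_unit.
(* All simple roots take the value 1 here; division by [M] brings every root below 1. *)
pose v : 'cV[F]_n := invmx (map_mx intr Cm)^T *m const_mx 1.
have vi i : pairing (al i) v = 1.
  have : ((map_mx intr Cm)^T *m v) i 0 = 1 by rewrite mulKVmx // mxE.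
  by move=> <-; rewrite mxE; apply: eq_bigr => k _; rewrite !mxE.
pose M := (\sum_(w : Wt) \sum_i Num.bound `|pairing (val w *m al i) v|).+1%N.
have M_gt0 : 0 < (M%:R : F) by rewrite ltr0n.
exists (M%:R^-1 *: v); split=> [i|b [w [i [/wsP Ww ->]]]].
  by rewrite pairZr vi mulr1 invr_gt0.
rewrite pairZr mulrC ltr_pdivrMr // mul1r.
apply: le_lt_trans (ler_norm _) _.
apply: lt_le_trans (archi_boundP (normr_ge0 _)) _.
rewrite ler_nat /M ltnW // ltnS.
by rewrite (bigD1 (SeqSub Ww)) //= (bigD1 i) //= -addnA leq_addr.
Qed.

(** * Fixed points of alcove-preserving maps *)

Lemma Weyl_iter_order g : W g ->
  exists2 m : nat, (0 < m)%N & iter m (mulmx g) 1%:M = 1%:M.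
Proof.
move=> Wg; have one_in : 1%:M \in ws by apply/wsP; apply: Weyl1.
pose s := perm (wmul_inj Wg).
exists #[s]%g; first exact: order_gt0.
have it m : val (iter m s (SeqSub one_in)) = iter m (mulmx g) 1%:M.
  by elim: m => //= m <-; rewrite permE val_wmul.
by rewrite -it -permX expg_order perm1.
Qed.

(** Once the linear part has returned to 1, the orbit point differs from [c] by a coweight. Both lie
    in the alcove, so simple roots take integral values in (-1, 1) on the difference, which is thus
    0: the orbit is periodic and its average is fixed. *)
Lemma alcove_fixpoint g nu : W g -> coweight_vec nu ->
  (forall c, in_alcove c -> in_alcove (act g c + nu)) ->
  exists2 p, in_alcove p & act g p + nu = p.
Proof.
move=> Wg cnu stab; have [c ca] := alcove_nonempty.
have [m m_gt0 gm] := Weyl_iter_order Wg.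
pose cc k := iter k (fun v => act g v + nu) c.
have cca k : in_alcove (cc k) by elim: k => //= k; apply: stab.
have Wi k : W (iter k (mulmx g) 1%:M).
  by elim: k => [|k IH] /=; [apply: Weyl1 | apply: WeylM].
have trans k : coweight_vec (cc k - act (iter k (mulmx g) 1%:M) c).
  elim: k => [|k IH]; first by rewrite act1 subrr => i; rewrite pair0r.
  rewrite /= actM // addrAC -actB; apply: coweightD => //.
  exact: coweight_act.
have cm : cc m = c.
  apply/eqP; rewrite -subr_eq0; apply/eqP/pair_alpha_inj => i.
  have := trans m i; rewrite gm act1 => h; apply: (int_strict_bounds h).
  rewrite pairBr; have [a1 _] := cca m; have [_ a2] := cca m.
  have [a3 a4] := ca; move: (a1 i) (a2 _ (root_alpha i)) (a3 i) (a4 _ (root_alpha i)).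
  lra.
have m0 : 0 < m%:R :> F by rewrite ltr0n.
exists (m%:R^-1 *: \sum_(k < m) cc k).
  split=> [i|b rb]; rewrite pairZr pair_sumr.
    rewrite mulr_gt0 ?invr_gt0 //; case: (m) m_gt0 => // m' _.
    rewrite big_ord_recl ltr_pwDl //; first by have [h _] := cca 0%N; apply: h.
    by apply: sumr_ge0 => k _; have [h _] := cca (bump 0 k); apply/ltW/h.
  rewrite mulrC ltr_pdivrMr // mul1r.
  rewrite -[m in X in _ < X]card_ord -sumr_const; apply: ltr_sum => //.
    by apply/hasP; exists (Ordinal m_gt0); rewrite ?mem_index_enum.
  by move=> k _; have [_ h] := cca k; apply: h.
have shift : \sum_(k < m) cc k.+1 = \sum_(k < m) cc k.
  apply: (addrI (cc 0%N)); have := big_ord_recl m (fun k : 'I_m.+1 => cc k).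
  move=> <-; by rewrite big_ord_recr /= cm addrC; congr (_ + _).
rewrite actZ act_sum -[in RHS]shift big_split /= scalerDr; congr (_ + _).
by rewrite sumr_const card_ord -scaler_nat scalerA mulVf ?scale1r // gt_eqF.
Qed.

(** * Moving regular points into the alcove *)

(** A W-invariant form, the Killing form up to the multiplicities with which roots occur. Every root
    occurs, so [kform x x] bounds the square of each root value. *)
Definition kform x y : F := \sum_(w : Wt) \sum_i
  pairing (val w *m al i) x * pairing (val w *m al i) y.

Lemma kformC x y : kform x y = kform y x.
Proof. by apply: eq_bigr => w _; apply: eq_bigr => i _; rewrite mulrC. Qed.

Lemma kformDr x y y' : kform x (y + y') = kform x y + kform x y'.
Proof.
rewrite -big_split; apply: eq_bigr => w _; rewrite -big_split.
by apply: eq_bigr => i _; rewrite pairDr mulrDr.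
Qed.

Lemma kformZr x a y : kform x (a *: y) = a * kform x y.
Proof.
rewrite big_distrr; apply: eq_bigr => w _; rewrite /= big_distrr.
by apply: eq_bigr => i _; rewrite pairZr mulrCA.
Qed.

Lemma kformZl a x y : kform (a *: x) y = a * kform x y.
Proof. by rewrite kformC kformZr kformC. Qed.

Lemma kformDl x x' y : kform (x + x') y = kform x y + kform x' y.
Proof. by rewrite kformC kformDr !(kformC y). Qed.

Lemma kform_addZ y a z : kform (y + a *: z) (y + a *: z) =
  kform y y + 2 * a * kform z y + a ^+ 2 * kform z z.
Proof.
rewrite kformDr kformZr !kformDl !kformZl (kformC y z).
ring.
Qed.

Lemma kform_act g x y : W g -> kform (act g x) (act g y) = kform x y.
Proof.
move=> Wg; rewrite /kform (reindex_inj (wmul_inj Wg)); apply: eq_bigr => w _.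
apply: eq_bigr => i _; rewrite !pair_act val_wmul //.
by rewrite -(mulmxA g) mulKmx ?Weyl_unit.
Qed.

Lemma kform_sqr_le w i x : W w -> pairing (w *m al i) x ^+ 2 <= kform x x.
Proof.
move=> /wsP Ww; rewrite /kform (bigD1 (SeqSub Ww)) //= (bigD1 i) //= -addrA -expr2 lerDl.
rewrite addr_ge0 ?sumr_ge0 // => [j _|v _]; first by rewrite -expr2 sqr_ge0.
by rewrite sumr_ge0 // => j _; rewrite -expr2 sqr_ge0.
Qed.

(* [r] is the reflection in [b] and [bv] the coroot of [b]. *)
Lemma root_reflection b : root b -> exists r bv, [/\ W r, coroot_vec bv,
  pairing b bv = 2 & forall x, act r x = x - pairing b x *: bv].
Proof.
move=> [g [i [Wg bE]]]; exists (g *m S i *m invmx g), (act g (delta_mx i 0)).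
have WS := Weyl_sref i; have WV := Weyl_inv Wg.
split.
- by apply: WeylM => //; apply: WeylM.
- apply: coroot_act => k; rewrite mxE.
  by case: (_ && _); [apply: rpred1 | apply: rpred0].
- rewrite bE pair_act mulKmx ?Weyl_unit // /pairing (bigD1 i) //= big1 => [|j ji].
    by rewrite !mxE !eqxx Cm_diag mulr1 addr0.
  by rewrite [delta_mx _ _ _ _]mxE (negPf ji) mulr0.
- move=> x; rewrite -mulmxA actM //; last exact: WeylM.
  rewrite actM // act_sref actB actZ actK //; congr (_ - _ *: _).
  by rewrite pair_act invmxK bE.
Qed.

Lemma kform_reflection b : root b -> exists r bv, [/\ W r, coroot_vec bv,
  forall x, act r x = x - pairing b x *: bv & 0 < kform bv bv /\
  forall x, 2 * kform bv x = pairing b x * kform bv bv].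
Proof.
move=> rb; have [r [bv [Wr cbv b2 rE]]] := root_reflection rb.
exists r, bv; split=> //; split=> [|x].
  have [g [i [Wg bE]]] := rb.
  apply: lt_le_trans (kform_sqr_le i bv Wg); rewrite -bE b2.
  by rewrite exprn_gt0.
(* Invariance under [r], which sends [bv] to its opposite. *)
have := kform_act bv x Wr; rewrite !rE b2.
have -> : bv - 2 *: bv = (-1) *: bv by rewrite -[X in X - _]scale1r -scalerBl; congr (_ *: _); ring.
rewrite kformDr -scaleNr kformZr !kformZl.
by move=> h; lra.
Qed.

Lemma regular_affine w q v : W w -> coroot_vec q -> regular_vec v ->
  regular_vec (act w v + q).
Proof.
move=> Ww cq rv b rb; apply/negP=> h.
have rg : root (invmx w *m b) by apply: root_Weyl => //; apply: Weyl_inv.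
have /negP := rv _ rg; apply.
have -> : pairing (invmx w *m b) v = pairing b (act w v + q) - pairing b q.
  by rewrite pairDr pair_act addrK.
by rewrite rpredB // pair_coroot_int.
Qed.

(** A nearest point to [c] in the W_a-orbit exists, since only finitely many pairs do at least as
    well as [(1%:M, 0)]: the values [pairing (al i) q] are then bounded integers and determine
    [q]. *)
Lemma kform_min v c : exists w q, [/\ W w, coroot_vec q & forall w' q', W w' -> coroot_vec q' ->
  kform (act w v + q - c) (act w v + q - c) <= kform (act w' v + q' - c) (act w' v + q' - c)].
Proof.
have one_in : 1%:M \in ws by apply/wsP; apply: Weyl1.
pose D (p : 'M[int]_n * 'cV[F]_n) := act p.1 v + p.2 - c.
pose K p := kform (D p) (D p).
pose P p := [/\ W p.1, coroot_vec p.2 & K p <= K (1%:M, 0)].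
(* The summand 1 avoids a square root: [t ^+ 2 <= K] gives [|t| <= K + 1]. *)
pose bnd w i := K (1%:M, 0) + 1 + `|pairing (al i) (act w v)| + `|pairing (al i) c|.
pose N := (\sum_(w : Wt) \sum_i Num.bound (bnd (val w) i))%N.
have K0 p : 0 <= K p.
  by apply: sumr_ge0 => w _; apply: sumr_ge0 => i _; rewrite -expr2 sqr_ge0.
have bound p i : P p -> `|pairing (al i) p.2| <= N%:R.
  case: p => w q [/= Ww cq Kp].
  have wN : (Num.bound (bnd w i) <= N)%N.
    have Ww' := Ww; move/wsP: Ww' => Ww'.
    by rewrite /N (bigD1 (SeqSub Ww')) //= (bigD1 i) //= -addnA leq_addr.
  have b0 : 0 <= bnd w i by rewrite /bnd !addr_ge0.
  apply: le_trans (_ : (Num.bound (bnd w i))%:R <= _); last by rewrite ler_nat.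
  apply: ltW; apply: le_lt_trans (archi_boundP b0).
  have := kform_sqr_le i (D (w, q)) Weyl1; rewrite mul1mx -/(K (w, q)) => h.
  have -> : pairing (al i) q =
      pairing (al i) (D (w, q)) - pairing (al i) (act w v) + pairing (al i) c.
    by rewrite /D pairBr pairDr /=; ring.
  rewrite /bnd; apply: le_trans (ler_normD _ _) _; rewrite lerD2r.
  apply: le_trans (ler_normB _ _) _; rewrite lerD2r.
  move: (le_trans h Kp); set t := pairing _ _; rewrite -real_normK ?num_real // => ht.
  have := normr_ge0 t; nra.
pose phi (p : 'M[int]_n * 'cV[F]_n) : Wt * {ffun 'I_n -> 'I_(2 * N).+1} :=
  (insubd (SeqSub one_in) p.1,
   [ffun i => inord `|(Num.floor (pairing (al i) p.2) + N%:Z)%R|%N]).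
have phi_inj p p' : P p -> P p' -> phi p = phi p' -> p = p'.
  move=> Pp Pp' e; have B1 i := bound p i Pp; have B2 i := bound p' i Pp'.
  case: p p' Pp Pp' e B1 B2 => w q [w' q'] [/= Ww cq _] [/= Ww' cq' _] [e1 /ffunP e2] B1 B2.
  congr (_, _).
    by move/(congr1 val): e1; rewrite !insubdK //; apply/wsP.
  apply/eqP; rewrite -subr_eq0; apply/eqP/pair_alpha_inj => i.
  rewrite pairBr; have := e2 i; rewrite !ffunE => /(congr1 val) /=.
  have /intrP[z zE] := pair_coroot_int (al i) cq.
  have /intrP[z' zE'] := pair_coroot_int (al i) cq'.
  have := B1 i; have := B2 i; rewrite zE zE' !intrKfloor -!intr_norm -!(natz N).
  rewrite !pmulrn !ler_int => h1 h2.
  move=> e; suff -> : z = z' by rewrite subrr.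
  by move: e; rewrite !inordK; lia.
have [s [_ sP]] := finite_of_injective phi_inj.
have s1 : (1%:M, 0) \in s.
  by apply/sP; split=> //=; [apply: Weyl1 | move=> k; rewrite mxE rpred0].
have [m _ m_min] := @arg_minP _ F (seq_sub s) (SeqSub s1) xpredT (fun p => K (val p)) isT.
have [Wm cm Km] := (sP (val m)).1 (valP m).
exists (val m).1, (val m).2; split=> // w' q' Ww' cq'.
have [h|h] := lerP (K (w', q')) (K (1%:M, 0)); last first.
  by apply: ltW; apply: le_lt_trans Km h.
have ins : (w', q') \in s by apply/sP.
exact: (m_min (SeqSub ins) isT).
Qed.

(* Reflecting in a root hyperplane that separates [x] from a point [c] of the
   alcove brings [x] closer to [c]. *)
Lemma move_to_alcove v : regular_vec v ->
  exists w q, [/\ W w, coroot_vec q & in_alcove (act w v + q)].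
Proof.
move=> rv; have [c [c0 c1]] := alcove_nonempty.
have [w [q [Ww cq min]]] := kform_min v c; exists w, q; split=> //.
set x := act w v + q; have rx : regular_vec x by apply: regular_affine.
have x_min r q' : W r -> coroot_vec q' ->
    kform (x - c) (x - c) <= kform (act r x + q' - c) (act r x + q' - c).
  move=> Wr cq'; have := min (r *m w) (act r q + q') (WeylM Wr Ww) (corootD (coroot_act r cq) cq').
  by rewrite actM // addrA -actD.
clearbody x.
have sep b (k : int) : root b -> 0 <= (pairing b x - k%:~R) * (pairing b c - k%:~R).
  move=> rb; have [r [bv [Wr cbv rE [K0 K2]]]] := kform_reflection rb.
  (* The reflection in the hyperplane b = k is [r] followed by translation by [k%:~R *: bv];
     minimality compares [x] with its mirror image. *)
  have ckbv : coroot_vec (k%:~R *: bv) by move=> j; rewrite mxE rpredM ?intr_int.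
  have := x_min _ _ Wr ckbv; rewrite rE.
  set t := pairing b x - k%:~R.
  have -> : x - pairing b x *: bv + k%:~R *: bv - c = (x - c) + (- t) *: bv.
    have gen (a a' : F) (y : 'cV[F]_n) : y - a *: bv + a' *: bv - c = y - c + - (a - a') *: bv.
      by apply/colP=> j; rewrite !mxE; ring.
    exact: gen.
  rewrite kform_addZ -addrA lerDl => h.
  rewrite -(pmulr_rge0 _ K0); apply: le_trans h _; rewrite le_eqVlt; apply/orP; left.
  have -> : 2 * - t * kform bv (x - c) = - t * (2 * kform bv (x - c)) by ring.
  by rewrite K2 pairBr /t; apply/eqP; ring.
split=> [i|b rb].
  (* Level 0 for simple roots and level 1 for all roots bound the alcove; regularity of [x] makes
     the inequalities strict. *)
  have := sep _ 0 (root_alpha i); rewrite !subr0 => h; have ci := c0 i.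
  rewrite lt_def -(pmulr_lge0 _ ci) h andbT.
  by apply: contraNneq (rx _ (root_alpha i)) => ->; rewrite rpred0.
have := sep _ 1 rb; have cb := c1 _ rb => h.
rewrite lt_neqAle; apply/andP; split.
  by apply: contraNneq (rx _ rb) => ->; rewrite rpred1.
have cb' : pairing b c - 1 < 0 by rewrite subr_lt0.
by move: h; rewrite nmulr_lge0 // subr_le0.
Qed.

End Alcove.

(** * From vectors to torus elements *)

Section Exponential.
Variables (F : archiRealFieldType) (E : F -> CC).
Hypothesis E_add : forall a b, E (a + b) = E a * E b.
Hypothesis E0 : E 0 = 1.
Implicit Types (v : 'cV[F]_n) (l : 'cV[int]_n).

Definition texp v : 'I_n -> CC := fun k => E (v k 0).

Lemma exp_neq0 a : E a != 0.
Proof.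
apply/eqP=> e; have := E_add a (- a); rewrite subrr E0 e mul0r => /eqP.
by rewrite oner_eq0.
Qed.

Lemma expN a : E (- a) = (E a)^-1.
Proof.
by apply: (mulfI (exp_neq0 a)); rewrite -E_add subrr E0 mulfV // exp_neq0.
Qed.

Lemma exp_intM (z : int) a : E (z%:~R * a) = E a ^ z.
Proof.
have en (m : nat) : E (m%:R * a) = E a ^+ m.
  elim: m => [|m IH]; first by rewrite mul0r E0.
  by rewrite -natr1 mulrDl mul1r E_add IH exprSr.
case: z => m; first exact: en.
by rewrite NegzE intrN mulNr expN en.
Qed.

Lemma torus_texp v : torus (texp v).
Proof. by move=> k; apply: exp_neq0. Qed.

Lemma char_eval_texp l v : char_eval l (texp v) = E (pairing l v).
Proof.
rewrite /char_eval /pairing (big_morph E E_add E0); apply: eq_bigr => k _.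
by rewrite exp_intM.
Qed.

Lemma tact_texp g v k : tact g (texp v) k = texp (act g v) k.
Proof. by rewrite /tact char_eval_texp /texp -pair_fweight pair_act. Qed.

Hypothesis E_ker : forall a, E a = 1 <-> a \is a Num.int.

Lemma regular_texp v : regular_vec v -> regular Cm (texp v).
Proof.
move=> rv b rb; rewrite char_eval_texp; apply/eqP=> /E_ker h.
by have /negP := rv _ rb.
Qed.

Lemma exp_int_eq a b : a - b \is a Num.int -> E a = E b.
Proof. by move=> /E_ker e; rewrite -[a](subrK b) E_add e mul1r. Qed.

(** [E] kills the coroot translation, so [w] fixes the regular torus element [texp p]. *)
Lemma alcove_affine_stab w (q p : 'cV[F]_n) : W w -> coroot_vec q -> in_alcove p ->
  act w p + q = p -> w = 1%:M.
Proof.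
move=> Ww cq pa e; apply: (@regular_stab w (texp p)) => //; first exact: torus_texp.
  exact/regular_texp/alcove_regular.
move=> k; rewrite tact_texp; apply: exp_int_eq.
by rewrite -{2}e [X in _ - X]mxE opprD addrA subrr add0r rpredN.
Qed.

Lemma fixpoint_twist g (nu v : 'cV[F]_n) : W g -> coweight_vec nu ->
  in_alcove v -> in_alcove (act g v + nu) ->
  exists u, [/\ torus u, regular Cm u & forall k, tact g u k = texp nu k * u k].
Proof.
move=> Wg cnu va gva; have [|p pa pE] := alcove_fixpoint Wg cnu.
  by move=> c; apply: alcove_preserved va gva.
(* The sign turns g(p) = p - nu into g(-p) = nu + (-p). *)
exists (texp (- p)); split=> [||k]; first exact: torus_texp.
  apply: regular_texp => b rb; rewrite pairNr rpredN; exact: alcove_regular.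
have e : act g p = p - nu by rewrite -{2}pE addrK.
rewrite tact_texp actN e /texp -E_add; congr E; rewrite !mxE; ring.
Qed.

End Exponential.

(** * Moving off the root hyperplanes *)

Lemma regular_perturb (F : archiRealFieldType) (t a : 'cV[F]_n) :
  (forall b, root b -> pairing b t \is a Num.int -> pairing b a != 0) ->
  exists e : F, regular_vec (t + e *: a).
Proof.
move=> reg.
(* An integral value of [b] at [t] is moved by a nonzero amount less than 1; any other value stays
   strictly between its floor and the next integer. *)
have one b : root b -> exists2 m : F, 0 < m &
    forall e, 0 < e < m -> pairing b (t + e *: a) \isn't a Num.int.
  move=> rb; have A0 := normr_ge0 (pairing b a); set A := `|_| in A0.
  (* [A] itself may be 0, so it cannot serve as a divisor. *)
  have A1 : 0 < A + 1 by lra.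
  have small e m : 0 < e < m / (A + 1) -> `|e * pairing b a| < m.
    move=> /andP[e0 em]; rewrite normrM (gtr0_norm e0) -/A.
    by move: em; rewrite ltr_pdivlMr // => em; nra.
  have [tb|tb] := boolP (pairing b t \is a Num.int).
    exists (1 / (A + 1)) => [|e he]; first by rewrite divr_gt0.
    rewrite pairDr pairZr rpredDl //; apply/negP=> /int_strict_bounds h.
    have := small _ _ he; rewrite ltr_norml => /h /eqP; rewrite mulf_eq0.
    by case/andP: he => e0 _; rewrite (gt_eqF e0) (negPf (reg _ rb tb)).
  have /andP[f1 f2] := floor_itv (pairing b t); set f := Num.floor _ in f1 f2.
  have f1' : f%:~R < pairing b t.
    by rewrite lt_neqAle f1 andbT; apply: contraNneq tb => <-; apply: intr_int.
  rewrite intrD in f2.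
  pose m := Num.min (pairing b t - f%:~R) (f%:~R + 1 - pairing b t).
  have m0 : 0 < m by rewrite lt_min; apply/andP; split; lra.
  exists (m / (A + 1)) => [|e he]; first by rewrite divr_gt0.
  have := small _ _ he; rewrite lt_min => /andP[]; rewrite !ltr_norml => /andP[s1 s2] /andP[s3 s4].
  rewrite pairDr pairZr; apply/negP=> /intrP[z zE].
  have z1 : f < z by rewrite -(ltr_int F) -zE; lra.
  have z2 : z < f + 1 by rewrite -(ltr_int F) -zE intrD; lra.
  lia.
have all_pos (s : seq 'cV[int]_n) : {subset s <= ps} -> exists2 m : F, 0 < m &
    forall e, 0 < e < m -> forall b, b \in s -> pairing b (t + e *: a) \isn't a Num.int.
  elim: s => [|b s IH] sub; first by exists 1.
  have [x xs|m m0 mP] := IH; first by apply: sub; rewrite inE xs orbT.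
  have [rb _] := (psP b).1 (sub b (mem_head _ _)).
  have [m' m0' mP'] := one b rb; exists (Num.min m m') => [|e]; first by rewrite lt_min m0.
  rewrite lt_min => /and3P[e0 em em'] c; rewrite inE => /orP[/eqP ->|cs].
    by apply: mP'; rewrite e0.
  by apply: mP => //; rewrite e0.
have [m m0 mP] := all_pos ps (fun x => id).
have hm : 0 < m / 2 < m by apply/andP; split; lra.
exists (m / 2) => b rb; have [b0|b0] := root_pm rb.
  by apply: (mP _ hm); apply/psP.
have : pairing (- b) (t + (m / 2) *: a) \isn't a Num.int.
  by apply: (mP _ hm); apply/psP; split=> //; apply: root_opp.
by rewrite pairNl rpredN.
Qed.

(** * Uniqueness up to conjugation *)

(** For c = w(t) + q and g' = w g w^-1, modulo coroots c - g'(c) is w(t - g(t)), hence -w(th), hence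
    -th because W acts trivially on coweights modulo coroots. *)
Lemma alcove_conjugate (F : archiRealFieldType) g (t th : 'cV[F]_n) :
  W g -> coweight_vec th -> regular_vec t -> coroot_vec (act g t - t - th) ->
  exists w c, [/\ W w, in_alcove c & coroot_vec (c - act (w *m g *m invmx w) c + th)].
Proof.
move=> Wg cth rt cg; have [w [q [Ww cq ca]]] := move_to_alcove rt.
exists w, (act w t + q); split=> //.
have WV := Weyl_inv Ww; have Wwg := WeylM Ww Wg.
set q1 := act g t - t - th in cg.
have gt : act g t = t + th + q1 by rewrite /q1; apply/colP=> i; rewrite !mxE; ring.
have -> : act w t + q - act (w *m g *m invmx w) (act w t + q) + th =
    q - (act w th - th) - act w q1 - act (w *m g *m invmx w) q.
  rewrite (actD _ (act w t)) actM // actVK // actM // gt !actD.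
  move: (act w t) (act w th) (act w q1) (act _ q) => a1 a2 a3 a4.
  by apply/colP=> i; rewrite !mxE; ring.
do 2!(apply: corootD; last by apply/corootN/coroot_act).
by apply: corootD => //; apply/corootN/act_coweight_sub.
Qed.

Lemma alcove_conj_unique (F : archiRealFieldType) (E : F -> CC) h1 h2 (c1 c2 th : 'cV[F]_n) :
  (forall a b, E (a + b) = E a * E b) -> E 0 = 1 ->
  (forall a, E a = 1 <-> a \is a Num.int) ->
  W h1 -> W h2 -> coweight_vec th -> in_alcove c1 -> in_alcove c2 ->
  coroot_vec (c1 - act h1 c1 + th) -> coroot_vec (c2 - act h2 c2 + th) -> h1 = h2.
Proof.
move=> E_add E0 E_ker Wh1 Wh2 cth a1 a2 q1 q2.
have cw h c : coroot_vec (c - act h c + th) -> coweight_vec (c - act h c).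
  move=> /coroot_coweight q i; have -> : c - act h c = (c - act h c + th) - th by rewrite addrK.
  by rewrite pairBr rpredB.
set nu1 := c1 - act h1 c1 in q1; set nu2 := c2 - act h2 c2 in q2.
have cn1 : coweight_vec nu1 by apply: cw.
have cn2 : coweight_vec nu2 by apply: cw.
have g2c2 : act h2 c2 + nu2 = c2 by rewrite /nu2 addrC subrK.
have g1c1 : in_alcove (act h1 c1 + nu1) by rewrite /nu1 addrC subrK.
have g1c2 : in_alcove (act h1 c2 + nu1) by apply: (alcove_preserved Wh1 cn1 a1 g1c1 a2).
have WV := Weyl_inv Wh2.
pose w := h1 *m invmx h2; have Ww : W w by apply: WeylM.
(* [(q, w)] is the first affine map composed with the inverse of the second; the translations agree
   modulo coroots, which puts it in W_a. *)
pose q := nu1 - act w nu2.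
have cq : coroot_vec q.
  have -> : q = (nu1 + th) - act w (nu2 + th) + (act w th - th).
    by rewrite /q actD; apply/colP=> i; rewrite !mxE; ring.
  apply: corootD; last exact: act_coweight_sub.
  by apply: corootD => //; apply/corootN/coroot_act.
have wq : act w c2 + q = act h1 c2 + nu1.
  rewrite /q -{1}g2c2 actD {1}/w actM // actVK //.
  by rewrite addrACA subrr addr0.
have wa : in_alcove (act w c2 + q) by rewrite wq.
have cwq : coweight_vec q by apply: coroot_coweight.
have [|p pa pE] := alcove_fixpoint Ww cwq.
  by move=> c; apply: alcove_preserved a2 wa.
have := alcove_affine_stab E_add E0 E_ker Ww cq pa pE.
move/(congr1 (mulmx^~ h2)); rewrite /w -mulmxA mulVmx ?Weyl_unit //.
by rewrite mulmx1 mul1mx.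
Qed.

(** * Real and rational alcoves *)

Lemma pair_ratr l (v : 'cV[rat]_n) (R : archiRealFieldType) :
  pairing l (map_mx ratr v : 'cV[R]_n) = ratr (pairing l v).
Proof.
rewrite /pairing rmorph_sum; apply: eq_bigr => k _.
by rewrite mxE rmorphM /= ratr_int.
Qed.

Lemma in_alcove_ratr (v : 'cV[rat]_n) (R : archiRealFieldType) :
  in_alcove (map_mx ratr v : 'cV[R]_n) <-> in_alcove v.
Proof.
have r1 : 1 = ratr 1 :> R by rewrite rmorph1.
split=> -[h1 h2]; split=> [i|b rb].
- by have := h1 i; rewrite pair_ratr ltr0q.
- by have := h2 b rb; rewrite pair_ratr r1 ltr_rat.
- by rewrite pair_ratr ltr0q.
- by rewrite pair_ratr r1 ltr_rat h2.
Qed.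

Lemma alcoveP h (v : 'cV[Rdefinitions.R]_n) : highest_root Cm h ->
  alcove Cm h v <-> in_alcove v.
Proof.
move=> [rh hh]; split=> [[a1 a2]|[a1 a2]]; last first.
  by split=> [i|]; [apply: a1 | apply: a2].
have a1' i : 0 < pairing (al i) v by apply: a1.
split=> // b rb; apply: le_lt_trans a2.
have [c cE] := hh _ rb; change (pairing b v <= pairing h v).
have -> : pairing h v = pairing b v + pairing (Cm *m \col_i (c i)%:Z) v.
  rewrite -pairDl; congr (pairing _ v); apply/eqP; rewrite addrC -subr_eq cE; apply/eqP.
  rewrite [X in _ *m X]col_sum_fweight mulmx_sumr; apply: eq_bigr => i _.
  by rewrite -scalemxAr mxE -colE -scaler_nat natz.
rewrite lerDl pair_Cm sumr_ge0 // => i _.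
by rewrite mxE mulr_ge0 ?ler0z // ltW.
Qed.

Lemma coweightP (m : 'cV[rat]_n) : coweight Cm m <-> coweight_vec m.
Proof. by split=> h i; [apply/intrP/h | have /intrP := h i]. Qed.

(** The alcove in [is_psi] is real while [iota] lives on [rat]; a rational point [c] of the alcove
    brings the stabilization condition down to [rat]. *)
Lemma psi_alcove mu g : is_psi Cm mu g -> W g /\ exists nu c : 'cV[rat]_n,
  [/\ coweight_vec nu, coroot_vec (nu - mu), in_alcove c & in_alcove (act g c + nu)].
Proof.
move=> [Wg [nu [h [/coweightP cnu congr hh [stab _]]]]]; split=> //.
have [c ca] := alcove_nonempty rat; exists nu, c; split=> //.
  by move=> k; rewrite !mxE; apply/intrP/congr.
have /(alcoveP _ hh) := stab _ ((alcoveP _ hh).2 ((in_alcove_ratr c _).2 ca)).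
have -> : eaff nu g (map_mx ratr c) = map_mx ratr (act g c + nu).
  rewrite /eaff map_mxD addrC map_mxM; congr (_ *m _ + _).
  by rewrite -map_mx_comp; apply: eq_map_mx => z /=; rewrite ratr_int.
by move/in_alcove_ratr.
Qed.

Lemma char_eval_polar l (a t : 'cV[Rdefinitions.R]_n) :
  char_eval l (fun k => polar (a k 0) (t k 0)) = polar (pairing l a) (pairing l t).
Proof.
have polarE b s : polar b s = polar b 0 * polar 0 s :> CC by rewrite -polarD addr0 add0r.
have E1 b b' : polar (b + b') 0 = polar b 0 * polar b' 0 :> CC by rewrite -polarD addr0.
have E2 s s' : polar 0 (s + s') = polar 0 s * polar 0 s' :> CC by rewrite -polarD addr0.
rewrite [RHS]polarE -(char_eval_texp E1 (polar00 _)) -(char_eval_texp E2 (polar00 _)).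
by rewrite -char_evalM; congr char_eval; apply/funext => k; rewrite polarE.
Qed.

Lemma polar_inj (R : realType) (a a' t t' : R) :
  polar a t = polar a' t' -> a = a' /\ t - t' \is a Num.int.
Proof.
move=> e; have : polar (a - a') (t - t') = 1.
  by rewrite polarD e -polarD !subrr polar00.
by move/polar_eq1 => [/eqP]; rewrite subr_eq0 => /eqP.
Qed.

Lemma torus_polar (u : 'I_n -> CC) : torus u ->
  exists a t : 'cV[Rdefinitions.R]_n, u = fun k => polar (a k 0) (t k 0).
Proof.
move=> tu; have h k : exists p : Rdefinitions.R * Rdefinitions.R, u k = polar p.1 p.2.
  by have [a [t e]] := polar_surj (tu k); exists (a, t).
have [p pE] := choice h.
exists (\col_k (p k).1), (\col_k (p k).2); apply/funext => k.
by rewrite pE !mxE.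
Qed.

(** Simple roots are trivial on [x], so they vanish on its modulus part, which is therefore 0, and
    are integral on its angle part. *)
Lemma center_polar x : center Cm x -> exists2 th : 'cV[Rdefinitions.R]_n,
  coweight_vec th & x = fun k => polar 0 (th k 0).
Proof.
move=> [tx x1]; have [a [th xE]] := torus_polar tx.
have h i : pairing (al i) a = 0 /\ pairing (al i) th \is a Num.int.
  by apply: polar_eq1; rewrite -char_eval_polar -xE; apply/x1/root_alpha.
exists th; first by move=> i; case: (h i).
have a0 : a = 0 by apply: pair_alpha_inj => i; case: (h i).
by rewrite xE a0; apply/funext => k; rewrite mxE.
Qed.

(* The positive part of [u] is fixed by [g], so it can be used to move the
   compact part of [u] off the root hyperplanes. *)
Lemma regular_real g x u (th : 'cV[Rdefinitions.R]_n) : x = (fun k => polar 0 (th k 0)) ->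
  torus u -> regular Cm u -> (forall k, tact g u k = x k * u k) ->
  exists2 t : 'cV[Rdefinitions.R]_n, regular_vec t & coroot_vec (act g t - t - th).
Proof.
move=> xE tu ru gu; have [a [t uE]] := torus_polar tu.
have guE k : polar (act g a k 0) (act g t k 0) = polar (a k 0) (th k 0 + t k 0).
  have := gu k; rewrite xE uE -polarD add0r => <-.
  by rewrite /tact char_eval_polar -!pair_act !pair_fweight.
have ga : act g a = a by apply/colP=> k; case: (polar_inj (guE k)).
(* If [b] were integral on [t] and zero on [a], then b(u) = 1, against regularity of [u]. *)
have [b rb bt|e re] := @regular_perturb _ t a.
  apply/eqP=> ba; have /eqP := ru _ rb; apply; rewrite uE char_eval_polar ba.
  by have /intrP[z ->] := bt; rewrite polar_int.
exists (t + e *: a) => // k; rewrite actD actZ ga.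
have [_] := polar_inj (guE k).
have -> // : (act g t + e *: a - (t + e *: a) - th) k 0 = act g t k 0 - (th k 0 + t k 0).
move: (act g t) => gt; rewrite !mxE; ring.
Qed.

Lemma conj_unique x g1 g2 u1 u2 : center Cm x -> W g1 -> W g2 ->
  torus u1 -> regular Cm u1 -> (forall k, tact g1 u1 k = x k * u1 k) ->
  torus u2 -> regular Cm u2 -> (forall k, tact g2 u2 k = x k * u2 k) ->
  exists w, W w /\ g2 = w *m g1 *m invmx w.
Proof.
move=> cx Wg1 Wg2 tu1 ru1 gu1 tu2 ru2 gu2.
have [th cth xE] := center_polar cx.
have [t1 rt1 ct1] := regular_real xE tu1 ru1 gu1.
have [t2 rt2 ct2] := regular_real xE tu2 ru2 gu2.
have [w1 [c1 [Ww1 a1 q1]]] := alcove_conjugate Wg1 cth rt1 ct1.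
have [w2 [c2 [Ww2 a2 q2]]] := alcove_conjugate Wg2 cth rt2 ct2.
have V1 := Weyl_inv Ww1; have V2 := Weyl_inv Ww2.
have polar_ker (a : Rdefinitions.R) : polar 0 a = 1 :> CC <-> a \is a Num.int.
  by split=> [/polar_eq1[]|/intrP[z ->]] //; apply: polar_int.
have polar_add (a b : Rdefinitions.R) : polar 0 (a + b) = polar 0 a * polar 0 b :> CC.
  by rewrite -polarD addr0.
have e : w1 *m g1 *m invmx w1 = w2 *m g2 *m invmx w2.
  apply: (alcove_conj_unique polar_add (polar00 _) polar_ker _ _ cth a1 a2 q1 q2).
    by apply: WeylM => //; apply: WeylM.
  by apply: WeylM => //; apply: WeylM.
exists (invmx w2 *m w1); have Ww : W (invmx w2 *m w1) by apply: WeylM.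
split=> //; have uw := Weyl_unit Ww.
apply: (can_inj (mulmxK uw)); rewrite mulmxKV //.
have u1' := Weyl_unit Ww1; have u2' := Weyl_unit Ww2.
transitivity (invmx w2 *m (w2 *m g2 *m invmx w2) *m w1).
  by rewrite -(mulmxA w2) mulKmx // !mulmxA.
by rewrite -e !mulmxA mulmxKV.
Qed.

(** Every class has a representative preserving the alcove: translate [c] by [th], then return to
    the alcove by an element [(q, w)] of W_a. The composite has linear part [w] and translation
    w(th) + q, congruent to [th]. *)
Lemma exists_twist (F : archiRealFieldType) (E : F -> CC) (th : 'cV[F]_n) :
  (forall a b, E (a + b) = E a * E b) -> E 0 = 1 ->
  (forall a, E a = 1 <-> a \is a Num.int) -> coweight_vec th ->
  exists g u, [/\ W g, torus u, regular Cm u & forall k, tact g u k = texp E th k * u k].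
Proof.
move=> E_add E0 E_ker cth; have [c ca] := alcove_nonempty F.
have rc : regular_vec (c + th).
  move=> b rb; apply/negP=> h; have /negP := alcove_regular ca rb; apply.
  by rewrite -[c](addrK th) pairBr rpredB // pair_root_int.
have [w [q [Ww cq wa]]] := move_to_alcove rc.
rewrite actD -addrA in wa.
have cnu : coweight_vec (act w th + q).
  by apply: coweightD; [apply: coweight_act | apply: coroot_coweight].
have [u [tu ru gu]] := fixpoint_twist E_add E0 E_ker Ww cnu ca wa.
exists w, u; split=> // k; rewrite gu; congr (_ * _).
apply: (exp_int_eq E_add E_ker); have := act_coweight_sub Ww cth k.
have := cq k; rewrite !mxE => h1 h2; rewrite addrAC; exact: rpredD.
Qed.

End RootTheory.

Theorem theorem4p4 (n : nat) (Cm : 'M[int]_n) (iota : rat -> CC) :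
  irreducible_finite_cartan Cm ->
  QZ_embedding iota ->
  forall x : 'I_n -> CC, center Cm x ->
  forall mu : 'cV[rat]_n, coweight Cm mu ->
  (forall l : 'cV[int]_n, char_eval l x = iota (pairQ l mu)) ->
  (* (a) *)
  (exists g u, [/\ Weyl Cm g, torus u, regular Cm u &
                   forall k, tact g u k = x k * u k])
  /\ (forall g, is_psi Cm mu g ->
        exists u, [/\ torus u, regular Cm u &
                      forall k, tact g u k = x k * u k])
  (* (b) *)
  /\ (forall g1 g2 u1 u2, Weyl Cm g1 -> Weyl Cm g2 ->
        torus u1 -> regular Cm u1 -> (forall k, tact g1 u1 k = x k * u1 k) ->
        torus u2 -> regular Cm u2 -> (forall k, tact g2 u2 k = x k * u2 k) ->
        exists w, Weyl Cm w /\ g2 = w *m g1 *m invmx w)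
  (* (c) *)
  /\ (forall g u, Weyl Cm g -> torus u -> regular Cm u ->
        (forall k, tact g u k = x k * u k) ->
        char_poly (lie_act g) =
          \prod_(i < n) ('X - ((char_eval (fweight i) x)^-1)%:P)).
Proof.
move=> [_ [Cm_diag Cm_off _] [d [d_gt0 d_sym d_pos]] _] [i_add i_ker] x cx mu cmu xmu.
have [ws [_ wsP]] := Weyl_finite Cm_diag d_gt0 d_sym d_pos.
have [ps psP] := positive_roots_finite Cm_diag d_gt0 d_sym d_pos.
have i0 : iota 0 = 1 by apply/i_ker; exists 0.
have iK (a : rat) : iota a = 1 <-> a \is a Num.int.
  by split=> [/i_ker/intrP|/intrP/i_ker].
have cmu' : coweight_vec Cm mu by apply/coweightP.
have xE k : x k = texp iota mu k.
  by rewrite -[LHS](char_eval_fweight k) xmu -[LHS](char_eval_texp i_add i0) char_eval_fweight.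
split; [|split; [|split]].
- have [g [u [Wg tu ru gu]]] := exists_twist Cm_diag Cm_off d_gt0 d_sym d_pos wsP i_add i0 iK cmu'.
  by exists g, u; split=> // k; rewrite gu xE.
- move=> g /(psi_alcove d_pos wsP)[Wg [nu [c [cnu cong ca ga]]]].
  have [u [tu ru gu]] := fixpoint_twist Cm_diag Cm_off d_gt0 d_sym d_pos wsP
    i_add i0 iK Wg cnu ca ga.
  exists u; split=> // k; rewrite gu xE; congr (_ * _).
  by apply: (exp_int_eq i_add iK); have := cong k; rewrite !mxE.
- move=> g1 g2 u1 u2 Wg1 Wg2 tu1 ru1 gu1 tu2 ru2 gu2.
  exact: (conj_unique Cm_diag Cm_off d_gt0 d_sym d_pos wsP psP cx Wg1 Wg2 tu1 ru1 gu1 tu2 ru2 gu2).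
- move=> g u Wg tu ru gu.
  exact: (char_poly_lie_act Cm_diag Cm_off d_gt0 d_sym d_pos wsP psP Wg tu ru cx gu).
Qed.
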